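(* Let $k\ge 3$ be an integer and let $S$ be a finite non-empty subset of an abelian group $G$ such that $S$ is not an arithmetic progression, $kS$ is aperiodic and $|kS|=k|S|-k+1$. Let $H$ be a hyper-atom of $S$ and let $S_0$ be an $H$-component of $S$ of smallest cardinality. Then $(S\setminus S_0)+H=S\setminus S_0$ and $|kS_0|=k|S_0|-k+1$. Moreover $\phi(S)$ is an arithmetic progression, where $\phi:G\to G/H$ denotes the canonical morphism.
   Context: Notation: $A+B=\{a+b: a\in A,\ b\in B\}$ and $kS=S+\cdots+S$ ($k$ summands). A set $A$ is aperiodic if $\{x\in G: x+A=A\}=\{0\}$. An arithmetic progression is a set of the form $\{a,a+d,\dots,a+(m-1)d\}$ with $m\ge 1$. For a subgroup $H$, an $H$-component of $S$ is a non-empty set of the form $S\cap(x+H)$. For a finite non-empty $S\subset G$ let $K$ be the subgroup generated by $S-S$; fix $a\in S$. If $S$ is not a coset of $K$, put $$\kappa_1(S)=\min\{|X+S|-|X| : X\subset K \text{ finite non-empty},\ X+(S-a)\neq K\}$$ (this does not depend on $a$). A ($1$-)fragment of $S$ is a finite non-empty set $X\subset K$ with $X+(S-a)\neq K$ and $|X+S|-|X|=\kappa_1(S)$. (It is known that some subgroup of $K$, possibly $\{0\}$, is a $1$-fragment of $S$.) A hyper-atom of $S$ is a maximal element (for inclusion) among the subgroups of $K$ that are $1$-fragments of $S$. *)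

(* Defs.v *)
From HB Require Import structures.
From mathcomp Require Export all_boot all_order all_algebra finmap.
From mathcomp Require Export generic_quotient ring_quotient.
From mathcomp Require Export boolp classical_sets cardinality.

Set Implicit Arguments.
Unset Strict Implicit.
Unset Printing Implicit Defensive.

Import GRing.Theory.

Local Open Scope classical_set_scope.
Local Open Scope ring_scope.

Section AdditiveSets.
Variable G : zmodType.
Implicit Types (A B S X H K : set G) (a x : G).

(* Only meaningful on finite sets: fset_set A is empty when A is infinite. *)
Definition card A : nat := #|` fset_set A|.

Definition sumset A B : set G := [set x + y | x in A & y in B].

Definition diffset A B : set G := [set x - y | x in A & y in B].

Definition translate x A : set G := [set x + y | y in A].

Definition ksum (k : nat) S : set G := iter k (sumset S) [set 0].

Definition aperiodic A : Prop := [set x | translate x A = A] = [set 0].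

Definition arith_prog A : Prop :=
  exists (a d : G) (m : nat), (0 < m)%N /\ A = [set a + d *+ i | i in `I_m].

Definition subgroup H : Prop :=
  H 0 /\ forall x y, H x -> H y -> H (x - y).

Definition gen_subgroup A : set G := smallest subgroup A.

Definition diff_subgroup S : set G := gen_subgroup (diffset S S).

Definition component H S C : Prop :=
  C !=set0 /\ exists x, C = S `&` translate x H.

Definition smallest_component H S C : Prop :=
  component H S C /\ forall D, component H S D -> (card C <= card D)%N.

(* The finite non-empty X over which the minimum defining kappa_1(S) ranges;
   a is the chosen base point of S. There is no such X exactly when S is a
   coset of diff_subgroup S. *)
Definition admissible S a X : Prop :=
  [/\ finite_set X, X !=set0, X `<=` diff_subgroup S &
      sumset X (translate (- a) S) <> diff_subgroup S].

(* The truncated subtraction is exact: card X <= card (sumset X S) for S finite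
   and non-empty. The default 0 is only used when no X is admissible. *)
Definition kappa1 S a : nat :=
  xget 0%N [set n |
    (exists2 X, admissible S a X & n = (card (sumset X S) - card X)%N) /\
    (forall X, admissible S a X -> (n <= card (sumset X S) - card X)%N)].

Definition fragment S a X : Prop :=
  admissible S a X /\ (card (sumset X S) - card X)%N = kappa1 S a.

Definition hyper_atom S a H : Prop :=
  [/\ subgroup H, fragment S a H &
      forall L, subgroup L -> fragment S a L -> H `<=` L -> L = H].

End AdditiveSets.

(* The canonical morphism G -> G / H; zmodClosed G is the type of subgroups of
   G (given as boolean predicates, which is no restriction classically). *)
Definition quot_map (G : zmodType) (H : zmodClosed G) :
  G -> Quotient.quot H := \pi_(Quotient.quot H)%qT.

(* Main.v *)
From HB Require Import structures.
Require Import Defs.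
From mathcomp Require Import zify.

Set Implicit Arguments.
Unset Strict Implicit.
Unset Printing Implicit Defensive.

Import GRing.Theory.

(** Translate S so that 0 is in S, let f : G -> G/H be the quotient map and
    T = f(S). Minimality of the fragment H makes T satisfy
    |Y + T| >= |Y| + |T| - 1 whenever Y + T is not the whole group, and
    maximality of H excludes non-trivial subgroups attaining equality.

    As kappa_1(S) <= |S| - 1, the set S misses fewer than |H| points of S + H,
    so that S_x + S_y is a full H-coset for distinct components. Hence kS is
    the union of kS_0 and of an H-periodic set; aperiodicity of kS forces these
    to be disjoint and k f(S_0) to have a unique representation in kT, which
    gives |kT| >= k|T| - k + 1. Comparing cardinalities, with Kneser's bound
    |kS_0| >= k|S_0| - k + 1 (obtained by the same reduction, by induction on
    |S|), all inequalities are equalities. This settles S_0, and gives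
    |2T| = 2|T| - 1 and |3T| = 3|T| - 2. A smallest set A with at least two
    elements and |A + T| = |A| + |T| - 1 then has two elements, and T is a
    progression; otherwise A meets its other translates in at most one point,
    which is impossible. *)

Local Open Scope fset_scope.
Local Open Scope ring_scope.

Lemma exists_minimal (T : Type) (m : T -> nat) (P : T -> Prop) :
  (exists x, P x) -> exists2 x, P x & forall y, P y -> (m x <= m y)%N.
Proof.
case=> x Px.
have [n] := ubnP (m x); elim: n => // n IHn in x Px *; rewrite ltnS => xn.
have [[y Py yx]|noy] := pselect (exists2 y, P y & (m y < m x)%N).
  by apply: (IHn y) => //; lia.
exists x => // y Py; rewrite leqNgt; apply/negP => yx; apply: noy.
by exists y.
Qed.

(** * Sums of finite sets *)

Section FiniteSets.
Variable G : zmodType.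
Implicit Types (A B C L P R S T X Y : {fset G}) (K N : set G) (x y z : G).

Definition fsum A B : {fset G} := [fset x + y | x in A, y in B].
Definition fshift x A : {fset G} := [fset x + y | y in A].
Definition fksum (k : nat) A : {fset G} := iter k (fsum A) [fset 0].

Local Notation "A `+` B" := (fsum A B) : fset_scope.

Lemma fsumP A B z :
  reflect (exists x y, [/\ x \in A, y \in B & z = x + y]) (z \in A `+` B).
Proof.
apply: (iffP (imfset2P _ _ _ _ _)) => /=.
  by case=> x xA [y yB ->]; exists x, y.
by case=> x [y [xA yB ->]]; exists x => //; exists y.
Qed.

Lemma mem_fsum A B x y : x \in A -> y \in B -> x + y \in A `+` B.
Proof. by move=> xA yB; apply/fsumP; exists x, y. Qed.

Lemma in_fshift x A y : (y \in fshift x A) = (y - x \in A).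
Proof.
apply/imfsetP/idP => /= [[z zA ->]|yA]; first by rewrite addrC addKr.
by exists (y - x) => //; rewrite addrC subrK.
Qed.

Lemma mem_fshift x A y : (x + y \in fshift x A) = (y \in A).
Proof. by rewrite in_fshift addrC addKr. Qed.

Lemma card_fshift x A : #|` fshift x A| = #|` A|.
Proof. by rewrite card_imfset //; apply: addrI. Qed.

Definition fopp A : {fset G} := [fset - x | x in A].

Lemma in_fopp A x : (x \in fopp A) = (- x \in A).
Proof.
apply/imfsetP/idP => /= [[y yA ->]|xA]; first by rewrite opprK.
by exists (- x); rewrite ?opprK.
Qed.

Lemma card_fopp A : #|` fopp A| = #|` A|.
Proof. by rewrite card_imfset //; apply: oppr_inj. Qed.

Lemma card_fset_gt1 A x y : x \in A -> y \in A -> x != y -> (1 < #|` A|)%N.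
Proof.
move=> xA yA xy; rewrite (cardfsD1 x) xA (cardfsD1 y (A `\ x)).
by rewrite in_fsetD1 eq_sym xy yA.
Qed.

Lemma card_gt1_neq A x : (1 < #|` A|)%N -> exists2 y, y \in A & y != x.
Proof.
move=> A1; have : (0 < #|` A `\ x|)%N.
  by have := cardfsD1 x A; case: (x \in A); lia.
by rewrite cardfs_gt0 => /fset0Pn[y /[!inE]/andP[yx yA]]; exists y.
Qed.

Lemma card_fset_gt2 A x y z : x \in A -> y \in A -> z \in A ->
  x != y -> x != z -> y != z -> (2 < #|` A|)%N.
Proof.
move=> xA yA zA xy xz yz; rewrite (cardfsD1 x) xA ltnS.
apply: (card_fset_gt1 (x := y) (y := z)) => //.
  by rewrite in_fsetD1 eq_sym xy.
by rewrite in_fsetD1 eq_sym xz.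
Qed.

Lemma card_gt2_neq A x y : (2 < #|` A|)%N ->
  exists z, [/\ z \in A, z != x & z != y].
Proof.
move=> A2; have /(card_gt1_neq y)[z] : (1 < #|` A `\ x|)%N.
  by have := cardfsD1 x A; case: (x \in A); lia.
by rewrite !inE => /andP[zx zA] zy; exists z.
Qed.

Lemma card_fsetU_disj A B : (forall x, x \in A -> x \notin B) ->
  #|` A `|` B| = (#|` A| + #|` B|)%N.
Proof.
by move=> /fdisjointP AB; apply/eqP; rewrite (leq_card_fsetU A B).2.
Qed.

Lemma fshift0 A : fshift 0 A = A.
Proof. by apply/fsetP=> y; rewrite in_fshift subr0. Qed.

Lemma fshiftD x y A : fshift x (fshift y A) = fshift (x + y) A.
Proof. by apply/fsetP=> z; rewrite !in_fshift opprD addrA. Qed.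

Lemma fshift_eq x A : {in A, forall y, x + y \in A} -> fshift x A = A.
Proof.
move=> xA; apply/eqP; rewrite eqEfcard card_fshift leqnn andbT.
by apply/fsubsetP => y; rewrite in_fshift => /xA; rewrite addrC subrK.
Qed.

Lemma fshift_eq_cardI x A :
  (#|` A| <= #|` A `&` fshift x A|)%N -> fshift x A = A.
Proof.
move=> cI; have /eqP AI : A `&` fshift x A == A by rewrite eqEfcard fsubsetIl.
apply/eqP; rewrite eq_sym eqEfcard card_fshift leqnn andbT -{1}AI.
exact: fsubsetIr.
Qed.

Lemma fsumC A B : A `+` B = B `+` A.
Proof.
by apply/fsetP=> z; apply/fsumP/fsumP => -[x [y [? ? ->]]];
  exists y, x; rewrite addrC.
Qed.

Lemma fsumA A B C : A `+` (B `+` C) = (A `+` B) `+` C.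
Proof.
apply/fsetP=> z; apply/fsumP/fsumP.
  move=> [x [_ [xA /fsumP[y [t [yB tC ->]]] ->]]]; exists (x + y), t.
  by rewrite addrA mem_fsum.
move=> [_ [t [/fsumP[x [y [xA yB ->]]] tC ->]]]; exists x, (y + t).
by rewrite addrA mem_fsum.
Qed.

Lemma fsum0s A : [fset 0] `+` A = A.
Proof.
apply/fsetP=> z; apply/fsumP/idP => [[x [y [/[!inE]/eqP-> yA ->]]]|zA].
  by rewrite add0r.
by exists 0, z; rewrite inE add0r.
Qed.

Lemma fsum_fshift x A B : fshift x A `+` B = fshift x (A `+` B).
Proof.
apply/fsetP=> z; rewrite in_fshift; apply/fsumP/fsumP.
  move=> [y [t [/[!in_fshift] yA tB ->]]]; exists (y - x), t.
  by rewrite addrAC.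
move=> [y [t [yA tB e]]]; exists (x + y), t; split=> //.
  by rewrite mem_fshift.
by rewrite -addrA -e addrC subrK.
Qed.

Lemma fsumS A A' B B' : A `<=` A' -> B `<=` B' -> A `+` B `<=` A' `+` B'.
Proof.
move=> /fsubsetP sA /fsubsetP sB; apply/fsubsetP => _ /fsumP[x [y [xA yB ->]]].
by rewrite mem_fsum ?sA ?sB.
Qed.

Lemma fsumUl A B C : (A `|` B) `+` C = (A `+` C) `|` (B `+` C).
Proof.
apply/fsetP=> z; rewrite inE; apply/fsumP/orP.
  by move=> [x [y [/[!inE]/orP[]xA yC ->]]]; [left|right]; rewrite mem_fsum.
by case=> /fsumP[x [y [xA yC ->]]]; exists x, y; rewrite inE xA ?orbT.
Qed.

Lemma fsum_subl A B : 0 \in B -> A `<=` A `+` B.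
Proof. by move=> B0; rewrite -{1}(fsum0s A) fsumC fsumS ?fsub1set. Qed.

Lemma leq_card_fsuml A B : B != fset0 -> (#|` A| <= #|` A `+` B|)%N.
Proof.
case/fset0Pn=> b bB; rewrite -(card_fshift b); apply/fsubset_leq_card/fsubsetP.
by move=> x; rewrite in_fshift => xA; rewrite -(subrK b x) mem_fsum.
Qed.

(** Submodularity: inclusion-exclusion for the two sums, as addition distributes over unions and the
    sum of the intersection lies in both. It serves to uncross minimisers. *)
Lemma card_fsum_submod A B S :
  (#|` (A `&` B) `+` S| + #|` (A `|` B) `+` S| <=
   #|` A `+` S| + #|` B `+` S|)%N.
Proof.
have := cardfsUI (A `+` S) (B `+` S); rewrite fsumUl => <-.
rewrite addnC leq_add2l; apply: fsubset_leq_card.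
by rewrite fsubsetI !fsumS ?fsubsetIl ?fsubsetIr.
Qed.

(** * Finite sets inside a possibly infinite subgroup *)

Definition fincl A K := forall x, x \in A -> K x.
(** Applied to sums lying in [K], where it expresses that the sum is not [K], also when [K] is
    infinite. *)
Definition misses K A := exists2 y, K y & y \notin A.
(* n <= |K|, in a form that also makes sense for infinite K. *)
Definition size_ge K n := forall A, (#|` A| < n)%N -> misses K A.

Lemma missesS K A B : A `<=` B -> misses K B -> misses K A.
Proof.
by move=> /fsubsetP AB [y Ky yB]; exists y => //; apply: contra yB; apply: AB.
Qed.

Lemma not_misses K A : ~ misses K A -> forall x, K x -> x \in A.
Proof. by move=> m x Kx; apply: contrapT => /negP xA; apply: m; exists x. Qed.

Lemma size_ge_fincl K A n : fincl A K -> (n <= #|` A|)%N -> size_ge K n.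
Proof.
move=> AK nA B Bn; apply: contrapT => /not_misses KB.
have /fsubset_leq_card : A `<=` B by apply/fsubsetP => x /AK /KB.
by lia.
Qed.

Lemma size_geW K m n : (m <= n)%N -> size_ge K n -> size_ge K m.
Proof. by move=> mn Kn A Am; apply: Kn; apply: leq_trans mn. Qed.

(** A witness against [size_ge] covers [K]; cutting it down to [K] exhibits [K] as a finite set, in
    which complements can be taken. *)
Lemma size_ge_or_fin K n :
  size_ge K n \/ exists2 E, (#|` E| < n)%N & forall x, (x \in E) <-> K x.
Proof.
have [|/existsNP[A /not_implyP[An /not_misses KA]]] := pselect (size_ge K n).
  by left.
right; exists [fset x in A | `[< K x >]].
  by apply: leq_ltn_trans An; apply/fsubset_leq_card/fset_sub.
move=> x; rewrite !inE; split; first by case/andP=> _ /asboolP.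
by move=> Kx; rewrite KA //=; apply/asboolP.
Qed.

Section Subgroup.
Variables (K : set G) (gK : subgroup K).

Lemma subgroup0 : K 0. Proof. by case: gK. Qed.

Lemma subgroupB x y : K x -> K y -> K (x - y).
Proof. by case: gK => _; apply. Qed.

Lemma subgroupN x : K x -> K (- x).
Proof. by move=> Kx; rewrite -sub0r; apply: subgroupB subgroup0 Kx. Qed.

Lemma subgroupD x y : K x -> K y -> K (x + y).
Proof. by move=> Kx Ky; rewrite -(opprK y); apply/subgroupB/subgroupN. Qed.

Lemma subgroupDl x y : K x -> K (x + y) -> K y.
Proof. by move=> Kx /subgroupB/(_ Kx); rewrite addrC addKr. Qed.

Lemma fincl_fsum A B : fincl A K -> fincl B K -> fincl (A `+` B) K.
Proof. by move=> AK BK _ /fsumP[x [y [/AK ? /BK ? ->]]]; apply: subgroupD. Qed.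

Lemma fincl_fshift x A : K x -> fincl A K -> fincl (fshift x A) K.
Proof.
by move=> Kx AK y; rewrite in_fshift => /AK/(subgroupD Kx); rewrite addrC subrK.
Qed.

Lemma misses_fshift x A : K x -> misses K A -> misses K (fshift x A).
Proof.
by move=> Kx [y Ky yA]; exists (x + y); rewrite ?mem_fshift //; apply: subgroupD.
Qed.

End Subgroup.

Lemma subgroup_closed A :
  0 \in A -> {in A, forall x, fshift x A = A} -> subgroup [set` A].
Proof.
move=> A0 Ash; split=> // x y /= xA yA.
by rewrite -(Ash y yA) in_fshift in xA.
Qed.

(** * Fragments and atoms *)

Definition admissible_fset K S Y :=
  [/\ Y != fset0, fincl Y K & misses K (Y `+` S)].

Lemma admissible_fshift K S Y x : subgroup K -> K x ->
  admissible_fset K S Y -> admissible_fset K S (fshift x Y).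
Proof.
move=> gK Kx [Y0 YK mY]; split; last by rewrite fsum_fshift; apply: misses_fshift.
  by rewrite -cardfs_gt0 card_fshift cardfs_gt0.
exact: fincl_fshift.
Qed.

Lemma admissibleI K S X Y : X `&` Y != fset0 ->
  admissible_fset K S X -> admissible_fset K S (X `&` Y).
Proof.
move=> XY0 [X0 XK mX]; split=> //; first by move=> x /[!inE]/andP[/XK].
by apply: missesS mX; rewrite fsumS ?fsubsetIl.
Qed.

(* If A is a smallest minimiser of |Y + S| - |Y|, any translate of A meeting A
   is A itself; when K is finite, the union still misses a point of K because
   -(K \ (A + S)) is also a minimiser, so has at least |A| elements. *)
Lemma exists_subgroup_fragment K S Y : subgroup K -> 0 \in S -> fincl S K ->
    admissible_fset K S Y ->
  exists P, [/\ subgroup [set` P], admissible_fset K S P &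
    forall X, admissible_fset K S X ->
      (#|` P `+` S| + #|` X| <= #|` X `+` S| + #|` P|)%N].
Proof.
move=> gK S0 SK admY.
have Sn0 : S != fset0 by apply/fset0Pn; exists 0.
pose ex X := (#|` X `+` S| - #|` X|)%N.
have exE X : #|` X `+` S| = (ex X + #|` X|)%N by rewrite subnK ?leq_card_fsuml.
have [Z admZ Zmin] := @exists_minimal _ ex _ (ex_intro _ Y admY).
pose frag X := admissible_fset K S X /\ ex X = ex Z.
have [A' [admA' exA'] A'min] := @exists_minimal _ (fun X => #|` X|) frag
  (ex_intro _ Z (conj admZ erefl)).
have [/fset0Pn[a aA'] A'K _] := admA'.
set A := fshift (- a) A'.
have Kna : K (- a) by apply: (subgroupN gK (A'K _ aA')).
have admA : admissible_fset K S A by apply: admissible_fshift.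
have exA : ex A = ex Z by rewrite -exA' /ex fsum_fshift !card_fshift.
have Amin X : admissible_fset K S X -> (ex X <= ex Z)%N -> (#|` A| <= #|` X|)%N.
  move=> admX exX; rewrite card_fshift A'min //; split=> //.
  by apply/eqP; rewrite eqn_leq exX Zmin.
have A0 : 0 \in A by rewrite in_fshift opprK add0r.
clearbody A; have [An0 AK mA] := admA.
have Kbig : size_ge K (#|` A `+` S| + #|` A|).
  have [//|[E Elt EK]] := size_ge_or_fin K (#|` A `+` S| + #|` A|).
  have ASE : A `+` S `<=` E.
    by apply/fsubsetP => x /(fincl_fsum gK AK SK)/EK.
  (* [D + S] avoids [-A], so |D + S| - |D| <= |A + S| - |A|; minimality of |A| then yields |A| <=
     |D| = |K| - |A + S|. *)
  pose D := fopp (E `\` (A `+` S)); pose NA := fopp A.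
  have cD : #|` D| = (#|` E| - #|` A `+` S|)%N by rewrite card_fopp cardfsDS.
  have cNA : #|` NA| = #|` A| by rewrite card_fopp.
  have DK : fincl D K.
    move=> x; rewrite in_fopp inE => /andP[_ /EK Kx].
    by rewrite -(opprK x); apply: subgroupN.
  have disj x : x \in NA -> x \notin D `+` S.
    rewrite in_fopp => xA; apply/negP.
    move=> /fsumP[y [s [/[!in_fopp]/[!inE] /andP[yA _] sS xE]]].
    by move: yA; rewrite -[- y](addrK (- s)) opprK -opprD -xE mem_fsum.
  have DSE : D `+` S `<=` E `\` NA.
    apply/fsubsetP => x xDS; rewrite inE; apply/andP; split.
      by apply/negP => /disj; rewrite xDS.
    by apply/EK; apply: (fincl_fsum gK DK SK).
  have NAE : NA `<=` E.
    apply/fsubsetP => x; rewrite in_fopp => /AK/(subgroupN gK).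
    by rewrite opprK => /EK.
  have := fsubset_leq_card DSE; rewrite cardfsDS // cNA => cDS.
  have [y Ky yA] := mA.
  have AS_lt : (#|` A `+` S| < #|` E|)%N.
    apply: fproper_ltn_card; rewrite fproperEneq ASE andbT.
    by apply: contra yA => /eqP ->; apply/EK.
  have admD : admissible_fset K S D.
    split=> //; first by rewrite -cardfs_gt0 cD; lia.
    exists 0; first exact: subgroup0.
    by apply: disj; rewrite in_fopp oppr0.
  have := exE A; have := exE D; have := Zmin _ admD.
  have := fsubset_leq_card NAE; rewrite cNA exA => NAle ZD eD eA.
  have := Amin _ admD; suff : (ex D <= ex Z)%N by move=> le /(_ le); lia.
  by lia.
have stab x : A `&` fshift x A != fset0 -> fshift x A = A.
  move=> ZA0; have admI := admissibleI ZA0 admA.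
  have [/fset0Pn[z /[!inE]/andP[zA zxA]] _ _] := admI.
  rewrite in_fshift in zxA; move/AK in zxA.
  have Kx : K x.
    by move: (subgroupB gK (AK _ zA) zxA); rewrite opprB addrC subrK.
  have := card_fsum_submod A (fshift x A) S.
  have := cardfsUI A (fshift x A).
  rewrite fsum_fshift !card_fshift => cUI csub.
  have [In0 _ _] := admI; rewrite -cardfs_gt0 in In0.
  have := Zmin _ admI; have := exE (A `&` fshift x A); have := exE A.
  rewrite exA => e1 e2 e3.
  have admU : admissible_fset K S (A `|` fshift x A).
    split; first by apply/fset0Pn; exists 0; rewrite inE A0.
      by move=> t /[!inE]/orP[/AK//|]; apply: fincl_fshift AK t.
    (* By submodularity and a non-empty intersection, the sum of the union with [S] has fewer than
       |A + S| + |A| elements. *)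
    by apply: Kbig; lia.
  have := Zmin _ admU; have := exE (A `|` fshift x A) => e4 e5.
  have cI : (#|` A| <= #|` A `&` fshift x A|)%N by apply: Amin => //; lia.
  exact: fshift_eq_cardI.
exists A; split=> //.
  apply: subgroup_closed => // x xA; apply: stab; apply/fset0Pn; exists x.
  by rewrite !inE xA in_fshift subrr.
move=> X admX; have := Zmin _ admX; have := exE A; have := exE X.
by rewrite exA; lia.
Qed.

(** In terms of the isoperimetric constant relative to [K]: kappa_1 is at least |S| - 1, the value
    at a one-point set. *)
Definition isoperimetric K S := forall Y, admissible_fset K S Y ->
  (#|` Y| + #|` S| <= (#|` Y `+` S|).+1)%N.

(** Equivalently, no nonzero element is a difference of two elements of [A] in two ways. *)
Definition sidon A := forall x, x != 0 -> (#|` A `&` fshift x A| <= 1)%N.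

(** Take a smallest set with at least two elements that attains equality. By submodularity a
    translate meeting it in two points coincides with it, so a nonzero period makes it a subgroup,
    and without one it is a Sidon set. *)
Lemma exists_two_atom K S X : subgroup K -> isoperimetric K S ->
    admissible_fset K S X -> (1 < #|` X|)%N ->
    ((#|` X `+` S|).+1 <= #|` X| + #|` S|)%N ->
    size_ge K (#|` X|.*2 + #|` S| - 2) ->
  exists A, [/\ 0 \in A, (1 < #|` A| <= #|` X|)%N, admissible_fset K S A,
    (#|` A `+` S|).+1 = (#|` A| + #|` S|)%N & subgroup [set` A] \/ sidon A].
Proof.
move=> gK iS admX X1 cX Kbig.
pose frag Y := [/\ admissible_fset K S Y, (1 < #|` Y|)%N &
  ((#|` Y `+` S|).+1 <= #|` Y| + #|` S|)%N].
have [A' [admA' A'1 cA'] A'min] := @exists_minimal _ (fun X => #|` X|) frag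
  (ex_intro _ X (And3 admX X1 cX)).
have [/fset0Pn[a aA'] A'K _] := admA'.
set A := fshift (- a) A'.
have Kna : K (- a) by apply: (subgroupN gK (A'K _ aA')).
have admA : admissible_fset K S A by apply: admissible_fshift.
have A1 : (1 < #|` A|)%N by rewrite card_fshift.
have cA : ((#|` A `+` S|).+1 <= #|` A| + #|` S|)%N.
  by rewrite fsum_fshift !card_fshift.
have AX : (#|` A| <= #|` X|)%N by rewrite card_fshift A'min.
have Amin Y : frag Y -> (#|` A| <= #|` Y|)%N.
  by move=> fY; rewrite card_fshift A'min.
have A0 : 0 \in A by rewrite in_fshift opprK add0r.
clearbody A; have [An0 AK mA] := admA.
have stab x : (1 < #|` A `&` fshift x A|)%N -> fshift x A = A.
  move=> I1; have In0 : A `&` fshift x A != fset0 by rewrite -cardfs_gt0; lia.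
  have admI := admissibleI In0 admA.
  have [/fset0Pn[z /[!inE]/andP[zA zxA]] _ _] := admI.
  rewrite in_fshift in zxA; move/AK in zxA.
  have Kx : K x.
    by move: (subgroupB gK (AK _ zA) zxA); rewrite opprB addrC subrK.
  have := card_fsum_submod A (fshift x A) S.
  have := cardfsUI A (fshift x A).
  rewrite fsum_fshift !card_fshift => cUI csub.
  have := iS _ admI => e1.
  have admU : admissible_fset K S (A `|` fshift x A).
    split; first by apply/fset0Pn; exists 0; rewrite inE A0.
      by move=> t /[!inE]/orP[/AK//|]; apply: fincl_fshift AK t.
    (* Two common points bound the sum of the union with [S] by 2|A| + |S| - 3, which stays below
       the size in [Kbig]. *)
    by apply: Kbig; lia.
  have := iS _ admU => e2.
  have cI : (#|` A| <= #|` A `&` fshift x A|)%N.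
    by apply: Amin; split=> //; lia.
  exact: fshift_eq_cardI.
exists A; split=> //; first by rewrite A1.
  by have := iS _ admA; lia.
have [[x x0 xA]|nper] := pselect (exists2 x, x != 0 & fshift x A = A).
  have Ax : x \in A by rewrite -xA in_fshift subrr.
  left; apply: subgroup_closed => // y yA; apply: stab.
  (* The period [x] puts both [y] and [x + y] into the intersection of [A] and [y + A]. *)
  apply: (@card_fset_gt1 _ y (x + y)).
  - by rewrite inE yA in_fshift subrr.
  - by rewrite inE in_fshift addrK Ax -xA mem_fshift yA.
  - by rewrite -subr_eq0 opprD addrCA subrr addr0 oppr_eq0.
right=> x x0; rewrite leqNgt; apply/negP => /stab xA; apply: nper.
by exists x.
Qed.

(** * Generated subgroups, stabilisers and sums with Sidon sets *)

Lemma subgroup_gen (U : set G) : subgroup (gen_subgroup U).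
Proof.
split=> [L [[] //]|x y Ux Uy L UL].
by apply: (subgroupB UL.1); [apply: Ux | apply: Uy].
Qed.

Lemma gen_subgroup_sub (U : set G) x : U x -> gen_subgroup U x.
Proof. by move=> Ux L [_]; apply. Qed.

Lemma gen_subgroup_min (U L : set G) :
  subgroup L -> (forall x, U x -> L x) -> forall x, gen_subgroup U x -> L x.
Proof. by move=> gL UL x; apply. Qed.

(** The stabiliser is finite because it lies in [-a + A] for every [a] in [A]. *)
Lemma exists_fstab A : A != fset0 ->
  exists L, [/\ subgroup [set` L], (#|` L| <= #|` A|)%N &
                forall x, (x \in L) <-> fshift x A = A].
Proof.
case/fset0Pn=> a aA.
pose L : {fset G} := [fset x in fshift (- a) A | fshift x A == A].
have LP x : (x \in L) <-> fshift x A = A.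
  rewrite !inE in_fshift opprK; split=> [/andP[_ /eqP]//|xA].
  by rewrite xA eqxx -{1}xA mem_fshift aA.
exists L; split=> //; last first.
  rewrite -(card_fshift (- a) A); apply/fsubset_leq_card/fsubsetP => x.
  by move=> /LP xA; rewrite in_fshift opprK -xA mem_fshift.
split=> [|x y /= /LP xA /LP yA]; first by apply/LP; apply: fshift0.
by apply/LP; rewrite -{1}yA fshiftD subrK.
Qed.

Lemma card_fshiftI x y A :
  #|` fshift x A `&` fshift y A| = #|` A `&` fshift (y - x) A|.
Proof.
rewrite -(card_fshift x (A `&` _)); congr #|` _|.
by apply/fsetP=> z; rewrite in_fshift !inE !in_fshift opprB addrA subrK.
Qed.

Lemma fshift_sub_fsum b A B : b \in B -> fshift b A `<=` B `+` A.
Proof.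
move=> bB; apply/fsubsetP => x; rewrite in_fshift => xA.
by rewrite -(subrK b x) addrC mem_fsum.
Qed.

Lemma sidon_card_fsum2 A B b c : sidon A -> b \in B -> c \in B -> b != c ->
  (#|` A|.*2 <= (#|` B `+` A|).+1)%N.
Proof.
move=> sA bB cB bc.
have := cardfsUI (fshift b A) (fshift c A); rewrite !card_fshift card_fshiftI.
have /sA : c - b != 0 by rewrite subr_eq0 eq_sym.
have : fshift b A `|` fshift c A `<=` B `+` A.
  by rewrite fsubUset !fshift_sub_fsum.
by move/fsubset_leq_card; lia.
Qed.

(** Bonferroni's inequality for three translates of [A], whose pairwise intersections have at most
    one element each. *)
Lemma sidon_card_fsum3 A B b c e : sidon A ->
  b \in B -> c \in B -> e \in B -> b != c -> b != e -> c != e ->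
  (3 * #|` A| <= #|` B `+` A| + 3)%N.
Proof.
move=> sA bB cB eB bc be ce.
have := cardfsUI (fshift b A) (fshift c A); rewrite !card_fshift card_fshiftI.
have /sA : c - b != 0 by rewrite subr_eq0 eq_sym.
have /sA : e - b != 0 by rewrite subr_eq0 eq_sym.
have /sA : e - c != 0 by rewrite subr_eq0 eq_sym.
have := cardfsUI (fshift b A `|` fshift c A) (fshift e A).
rewrite fsetIUl card_fshift.
have := cardfsUI (fshift b A `&` fshift e A) (fshift c A `&` fshift e A).
rewrite !card_fshiftI.
have : (fshift b A `|` fshift c A) `|` fshift e A `<=` B `+` A.
  by rewrite !fsubUset !fshift_sub_fsum.
by move/fsubset_leq_card; lia.
Qed.

(* A subgroup P violating the conclusion would have a coset containing more
   than half of its points in A, contradicting the Sidon property. *)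
Lemma sidon_isoperimetric A :
  0 \in A -> sidon A -> isoperimetric (gen_subgroup [set` A]) A.
Proof.
move=> A0 sA Y admY; set N := gen_subgroup _ in admY.
have gN : subgroup N := subgroup_gen _.
have AN : fincl A N by move=> x xA; apply: gen_subgroup_sub.
have [P [gP [P0 PN mP] Pmin]] := exists_subgroup_fragment gN A0 AN admY.
have {Pmin}Pmin := Pmin _ admY.
suff : (#|` P| + #|` A| <= (#|` P `+` A|).+1)%N by lia.
rewrite leqNgt; apply/negP => cP.
have P0' : 0 \in P by apply: (subgroup0 gP).
have cA : (#|` A| <= #|` P `+` A|)%N by rewrite fsumC; apply: leq_card_fsuml.
have [p pP p0] : exists2 p, p \in P & p != 0 by apply: card_gt1_neq; lia.
have [a aA aP] : exists2 a, a \in A & a \notin P.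
  apply: contrapT => /forall2NP AP; have [y Ny /negP] := mP; apply.
  apply: (fsubsetP (fsum_subl P A0)); apply: (gen_subgroup_min gP _ Ny) => x xA.
  by have [|/negP] := AP x => //; case/negPn.
have Psh x : #|` fshift x P `\` A| = (#|` P| - #|` fshift x P `&` A|)%N.
  by rewrite cardfsD card_fshift.
(* The trace [C] of [A] on a coset of [P] and its translate [p + C] lie in that coset and share at
   most one point. *)
have small x : (#|` fshift x P `&` A|.*2 <= #|` P| + 1)%N.
  set C := fshift x P `&` A; have := cardfsUI C (fshift p C).
  have : (#|` C `&` fshift p C| <= 1)%N.
    apply: leq_trans (sA p p0); apply/fsubset_leq_card/fsubsetP => z.
    by rewrite !inE !in_fshift => /andP[/andP[_ ->]]; rewrite inE => /andP[_ ->].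
  have : (#|` C `|` fshift p C| <= #|` P|)%N.
    rewrite -(card_fshift x P); apply/fsubset_leq_card/fsubsetP => z.
    rewrite !inE !in_fshift => /orP[/andP[]//|].
    rewrite inE in_fshift => /andP[h _].
    by have := subgroupD gP pP h; rewrite /= addrA [p + _]addrC subrK.
  by rewrite card_fshift; lia.
(* By [small], the cosets [P] and [a + P] have together at least |P| - 1 points outside [A], all of
   them in [P + A]; this contradicts [cP]. *)
have : (#|` (fshift 0 P `\` A) `|` (fshift a P `\` A)| <=
        #|` (P `+` A) `\` A|)%N.
  apply/fsubset_leq_card; rewrite -fsetDUl fsetSD // fsubUset fsumC.
  by rewrite !fshift_sub_fsum.
rewrite [X in (_ <= X)%N]cardfsDS; last by rewrite fsumC fsum_subl.
rewrite card_fsetU_disj; last first.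
  move=> z; rewrite !inE !in_fshift subr0 => /andP[_ zP]; rewrite negb_and.
  apply/orP; right; apply: contra aP => /(subgroupB gP zP).
  by rewrite /= opprB addrC subrK.
rewrite !Psh.
by have := small 0; have := small a; lia.
Qed.

(** The strict form of [isoperimetric] for finite non-trivial subgroups; in the quotient it
    expresses the maximality of the hyper-atom. *)
Definition no_subgroup_fragment K T := forall L, subgroup [set` L] ->
  admissible_fset K T L -> (1 < #|` L|)%N ->
  (#|` L| + #|` T| <= #|` L `+` T|)%N.

(** The stabiliser [L] of [R] is non-trivial, and [T] is covered by [R] and the coset [t + L]. Hence
    |L + T| <= |R| + |L| < |T| + |L|, against the absence of subgroup fragments. *)
Lemma no_fragment_coset K T R d t : subgroup K -> fincl T K ->
    no_subgroup_fragment K T -> size_ge K (3 * #|` T| - 2) ->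
    R `<=` T -> R != fset0 -> d != 0 -> fshift d R = R ->
    t \in T `\` R -> {in T `\` R, forall x, fshift (x - t) R = R} -> False.
Proof.
move=> gK TK nofrag Kbig RT Rn0 d0 dR tTR TRt.
have [L [gL LR LP]] := exists_fstab Rn0.
have L0 : 0 \in L by apply: (subgroup0 gL).
have LT : L `+` T `<=` R `|` fshift t L.
  apply/fsubsetP => _ /fsumP[x [y [xL yT ->]]]; rewrite inE.
  case: (boolP (y \in R)) => yR.
    by move/LP: xL => xR; rewrite -{1}xR mem_fshift yR.
  apply/orP; right; rewrite in_fshift -addrA; apply: (subgroupD gL xL).
  by apply/LP; apply: TRt; rewrite inE yR.
have := leq_trans (fsubset_leq_card LT) (leq_card_fsetU _ _).1.
rewrite card_fshift => cLT.
have cRT : (#|` R| < #|` T|)%N.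
  have := cardfsDS RT; have := fsubset_leq_card RT.
  have : (0 < #|` T `\` R|)%N by rewrite cardfs_gt0; apply/fset0Pn; exists t.
  by lia.
suff : (#|` L| + #|` T| <= #|` L `+` T|)%N by lia.
apply: nofrag => //; last first.
  by apply: (card_fset_gt1 L0 _ (_ : 0 != d)); rewrite 1?eq_sym //; apply/LP.
split; first by apply/fset0Pn; exists 0.
  move=> x /LP xR; have /fset0Pn[r rR] := Rn0.
  apply: (subgroupDl gK (x := r)); first by apply/TK/(fsubsetP RT).
  by apply/TK/(fsubsetP RT); rewrite -xR addrC mem_fshift.
by apply: Kbig; lia.
Qed.

(** Pigeonhole: if all these points lay in [A], two would coincide, so [d] would have finite order
    and [-d] would be one of its multiples, putting [x - d] into [A]. *)
Lemma exists_mulrn_notin A x d :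
  x - d \notin A -> exists i, x + d *+ i \notin A.
Proof.
move=> xdA; apply: contrapT => /forallNP allA.
have {}allA i : x + d *+ i \in A by have /negP/negPn := allA i.
pose f (i : 'I_(#|` A|).+1) : G := x + d *+ i.
have f_inj : injective f.
  suff fW (i j : 'I_(#|` A|).+1) : (i < j)%N -> f i <> f j.
    by move=> i j fij; apply/val_inj; case: (ltngtP i j) => // /fW; rewrite fij.
  move=> ij /addrI e; move: xdA; apply/negP/negPn.
  suff -> : - d = d *+ (j - i).-1 by [].
  apply/eqP; rewrite eq_sym -subr_eq0 opprK -mulrSr prednK ?subn_gt0 //.
  by rewrite mulrnBr 1?ltnW // e subrr.
pose F : {fset G} := [fset f i | i in 'I_(#|` A|).+1].
have : (#|` F| <= #|` A|)%N.
  by apply/fsubset_leq_card/fsubsetP => _ /imfsetP[i _ ->]; apply: allA.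
by rewrite card_imfset //= -cardE card_ord ltnn.
Qed.

(** Only one point of [T] has no predecessor and only one has no successor under adding [d]. So [T]
    is a progression together with a set invariant under [d], and [no_fragment_coset] forces that
    set to be empty. *)
Lemma arith_prog_of_pair K T d : subgroup K -> fincl T K ->
    no_subgroup_fragment K T -> size_ge K (3 * #|` T| - 2) ->
    d != 0 -> #|` T `|` fshift d T| = (#|` T|).+1 ->
  arith_prog [set` T].
Proof.
move=> gK TK nofrag Kbig d0 cdT.
have cI := cardfsUI T (fshift d T); rewrite card_fshift cdT in cI.
have [e eT] : exists e, fshift d T `\` T = [fset e].
  by apply/cardfs1P; rewrite cardfsD card_fshift fsetIC; apply/eqP; lia.
have [b bT] : exists b, T `\` fshift d T = [fset b].
  by apply/cardfs1P; rewrite cardfsD; apply/eqP; lia.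
have endP x : x \in T -> d + x \notin T -> d + x = e.
  by move=> xT xdT; apply/fset1P; rewrite -eT inE xdT mem_fshift xT.
have begP x : x \in T -> x - d \notin T -> x = b.
  by move=> xT xdT; apply/fset1P; rewrite -bT inE xT in_fshift xdT.
have /[!inE] /andP[] : b \in T `\` fshift d T by rewrite bT inE.
rewrite in_fshift => bdT bTT.
(* [m] is the length of the run of step [d] in [T] that starts at [b]. *)
have exm := exists_mulrn_notin bdT; case: (ex_minnP exm) => m mT mmin.
have m0 : (0 < m)%N by case: m mT {mmin} => //; rewrite addr0 bTT.
pose P : {fset G} := [fset b + d *+ val i | i in 'I_m].
have PP x : reflect (exists2 i, (i < m)%N & x = b + d *+ i) (x \in P).
  apply: (iffP (imfsetP _ _ _ _)) => [[i _ ->]|[i im ->]]; first by exists i.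
  by exists (Ordinal im).
have PT : P `<=` T.
  apply/fsubsetP => _ /PP[i im ->]; apply: contraLR im => /mmin.
  by rewrite leqNgt.
have bP : b \in P by apply/PP; exists 0%N; rewrite ?addr0.
case: (eqVneq (T `\` P) fset0) => [TP0|R0].
  exists b, d, m; split=> //; have -> : T = P.
    by apply/eqP; rewrite eqEfsubset PT andbT -fsetD_eq0 TP0.
  apply/seteqP; split=> x /=; first by move=> /PP[i im ->]; exists i.
  by move=> [i im <-]; apply/PP; exists i.
have dR : fshift d (T `\` P) = T `\` P.
  apply: fshift_eq => x /[!inE] /andP[xP xT].
  have xb : x <> b - d by move=> xE; move: bdT; rewrite -xE xT.
  have last_in : b + d *+ m.-1 \in P by apply/PP; exists m.-1; rewrite ?prednK.
  have lastE : d + (b + d *+ m.-1) = e.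
    apply: endP; first exact: (fsubsetP PT).
    by rewrite addrCA -mulrS prednK.
  apply/andP; split; last first.
    apply/negPn/negP => /(endP _ xT); rewrite -lastE => /addrI xE.
    by move: xP; rewrite xE last_in.
  apply: contra xP => /PP[[|i] im e'].
    by case: xb; rewrite -[x](addKr d) e' addr0 addrC.
  apply/PP; exists i; first exact: ltnW.
  by rewrite -[x](addKr d) e' mulrS addrCA addKr.
(* Points of the run differ from [b] by multiples of [d], which stabilise the remainder. *)
case: (@no_fragment_coset K T (T `\` P) d b) => //.
- exact: fsubsetDl.
- by rewrite !inE bP bTT.
move=> x; rewrite !inE negb_and negbK => /andP[/orP[/PP[i _ ->]|/negP//]] _.
rewrite addrC addKr; elim: i => [|i IHi]; first by rewrite fshift0.
by rewrite mulrS -fshiftD IHi.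
Qed.

Lemma subgroup_fstab A : subgroup [set x | fshift x A = A].
Proof.
split=> [|x y /= xA yA]; first exact: fshift0.
by rewrite -{1}yA fshiftD subrK.
Qed.

(** Let [B] be a two-atom of [A]. Two translates of [A] give |A| <= |B|. If [B] is a subgroup, [A]
    meets two of its cosets, so |B| < |A|. If [B] is a Sidon set, exchanging the roles gives |A| =
    |B|, and three translates need 3|A| - 3 <= 2|A| - 1, impossible for |A| > 2. *)
Lemma sidon_no_fragment K A X : subgroup K -> 0 \in A ->
    (forall L : set G, subgroup L -> fincl A L -> forall x, K x -> L x) ->
    sidon A -> (2 < #|` A|)%N -> isoperimetric K A -> admissible_fset K A X ->
    (1 < #|` X|)%N -> ((#|` X `+` A|).+1 <= #|` X| + #|` A|)%N ->
    size_ge K (#|` X|.*2 + #|` A| - 2) ->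
  False.
Proof.
move=> gK A0 Agen sA A3 iA admX X1 cX Kbig.
have [B [B0 /andP[B1 _] admB cB BS]] := exists_two_atom gK iA admX X1 cX Kbig.
have {X admX X1 cX Kbig iA} [b bB b0] := card_gt1_neq 0 B1.
have [|d dA d0] := card_gt1_neq (A := A) 0; first exact: ltnW.
have cAB : (#|` A| <= #|` B|)%N.
  have := sidon_card_fsum2 sA B0 bB; rewrite eq_sym => /(_ b0).
  by clear - cB; lia.
case: BS => [gB|sB].
  have [a aA aB] : exists2 a, a \in A & a \notin B.
    apply: contrapT => /forall2NP AB; have [_ _ [y Ky /negP]] := admB; apply.
    apply: (fsubsetP (fsum_subl B A0)); apply: (Agen _ gB _ _ Ky).
    by move=> x xA; have [|/negP] := AB x => //; case/negPn.
  have : (#|` fshift 0 B `|` fshift a B| <= #|` A `+` B|)%N.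
    by apply/fsubset_leq_card; rewrite fsubUset !fshift_sub_fsum.
  rewrite card_fsetU_disj.
    by rewrite !card_fshift fsumC; clear - cAB cB; lia.
  move=> z; rewrite !in_fshift subr0 => zB.
  by apply: contra aB => /(subgroupB gB zB); rewrite /= opprB addrC subrK.
have cBA : (#|` B| <= #|` A|)%N.
  have := sidon_card_fsum2 sB A0 dA; rewrite eq_sym [A `+` B]fsumC => /(_ d0).
  by clear - cB; lia.
have [c [cB' c0 cb]] := card_gt2_neq (A := B) 0 b (leq_trans A3 cAB).
have := sidon_card_fsum3 sA B0 bB cB'; rewrite !(eq_sym 0) (eq_sym b).
by move=> /(_ b0 c0 cb); clear - cB cBA A3; lia.
Qed.

(* A two-atom A of T either has two elements, which makes T a progression up to
   a periodic part, or is a Sidon set; in the latter case A generates K, and a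
   two-atom of A contradicts the Sidon property. *)
Lemma vosper_arith_prog K T : subgroup K -> 0 \in T -> fincl T K ->
    (forall L : set G, subgroup L -> fincl T L -> forall x, K x -> L x) ->
    isoperimetric K T -> no_subgroup_fragment K T -> (1 < #|` T|)%N ->
    ((#|` T `+` T|).+1 <= #|` T|.*2)%N -> size_ge K (3 * #|` T| - 2) ->
  arith_prog [set` T].
Proof.
move=> gK T0 TK Tgen iT nofrag T1 cTT Kbig.
have admT : admissible_fset K T T.
  split=> //; first by apply/fset0Pn; exists 0.
  by apply: Kbig; lia.
have [||A [A0 /andP[A1 AT] admA cA AS]] := exists_two_atom gK iT admT T1.
- by lia.
- by apply: size_geW Kbig; lia.
have [_ AK mAT] := admA.
case: AS => [gA|sA]; first by have := nofrag _ gA admA A1; lia.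
have [d dA d0] := card_gt1_neq 0 A1.
have [A2|A3] := leqP #|` A| 2.
  apply: (arith_prog_of_pair gK TK nofrag Kbig d0).
  have -> : T `|` fshift d T = A `+` T; last by lia.
  apply/eqP; rewrite eqEfsubset fsubUset fshift_sub_fsum // fsumC fsum_subl //=.
  apply/fsubsetP => _ /fsumP[t [x [tT xA ->]]]; rewrite inE.
  have : x \in [:: 0; d].
    apply: contraT; rewrite !inE negb_or => /andP[x0 xd].
    have := card_fset_gt2 A0 dA xA.
    by rewrite !(eq_sym _ x) (eq_sym 0) x0 xd d0; lia.
  rewrite !inE => /orP[]/eqP->; rewrite ?addr0 ?tT //.
  by rewrite addrC mem_fshift tT orbT.
pose N := gen_subgroup [set` A].
have gN : subgroup N := subgroup_gen _.
have AN : fincl A N by move=> x xA; apply: gen_subgroup_sub.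
have iN : isoperimetric N A by apply: sidon_isoperimetric.
have NK x : N x -> K x by apply: gen_subgroup_min.
pose C t : {fset G} := [fset x in T | `[< N (x - t) >]].
have CP t x : reflect (x \in T /\ N (x - t)) (x \in C t).
  by rewrite !inE; apply: (iffP andP) => -[? /asboolP].
(* Either [A + T] fills every coset of [N] met by [T], or the isoperimetric inequality for [A] in
   [N] applies to the part of [T] in some coset. *)
have [[t tT mt]|allfull] :=
    pselect (exists2 t, t \in T & misses N (fshift (- t) (C t) `+` A));
    last first.
  have {}allfull t x : t \in T -> N x -> x + t \in A `+` T.
    move=> tT Nx; have /not_misses : ~ misses N (fshift (- t) (C t) `+` A).
      by move=> m; apply: allfull; exists t.
    move=> /(_ _ Nx); rewrite fsum_fshift in_fshift opprK fsumC.
    by apply: fsubsetP; apply: fsumS => //; apply/fsubsetP => y /CP[].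
  (* As [0] is in [T], the group [N] lies in [A + T], so it is finite; N + T = A + T then makes it a
     subgroup excluded by [nofrag]. *)
  pose L : {fset G} := [fset x in A `+` T | `[< N x >]].
  have LP x : (x \in L) <-> N x.
    rewrite !inE; split=> [/andP[_ /asboolP]//|Nx].
    by apply/andP; split; [rewrite -[x]addr0; apply: allfull | apply/asboolP].
  have AL : A `<=` L by apply/fsubsetP => x /AN/LP.
  have LT : L `+` T = A `+` T.
    apply/eqP; rewrite eqEfsubset [X in _ && X]fsumS // andbT.
    by apply/fsubsetP => _ /fsumP[x [y [/LP Nx yT ->]]]; apply: allfull.
  have cL := fsubset_leq_card AL.
  suff : (#|` L| + #|` T| <= #|` L `+` T|)%N by rewrite LT; lia.
  apply: nofrag; last by lia.
    split=> [|x y /LP Nx /LP Ny]; first by apply/LP; apply: (subgroup0 gN).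
    by apply/LP; apply: (subgroupB gN).
  split; last by rewrite LT.
    by rewrite -cardfs_gt0; lia.
  by move=> x /LP/NK.
move: {CP} (C t) (CP t) mt => {}C CP mt.
have tC : t \in C by apply/CP; rewrite subrr; split=> //; apply: (subgroup0 gN).
have cC : (#|` C| + #|` A| <= (#|` C `+` A|).+1)%N.
  rewrite -(card_fshift (- t) (C)) -(card_fshift (- t) (C `+` A)) -fsum_fshift.
  apply: iN; split=> //.
    by apply/fset0Pn; exists 0; rewrite in_fshift opprK add0r.
  by move=> x; rewrite in_fshift opprK => /CP[_]; rewrite addrK.
have [R defR] : exists R, R = T `\` C by eexists.
have CT : C `<=` T by apply/fsubsetP => x /CP[].
have cR : #|` R| = (#|` T| - #|` C|)%N by rewrite defR cardfsDS.
(* Adding [A] enlarges [C] by at least |A| - 1 elements, which is the whole gain of [T], so it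
   cannot enlarge the rest. *)
have RA : R `+` A = R.
  apply/eqP; rewrite eq_sym eqEfcard fsum_subl // andTb.
  have : (#|` (C `+` A) `|` (R `+` A)| <= #|` A `+` T|)%N.
    rewrite -fsumUl fsumC; apply/fsubset_leq_card/fsumS => //.
    by rewrite fsubUset CT defR fsubsetDl.
  rewrite card_fsetU_disj; last first.
    move=> _ /fsumP[x [a [/CP[xT xt] aA ->]]]; apply/negP.
    move=> /fsumP[y [b [/[!defR]/fsetDP[yT /negP yC] bA e]]].
    apply: yC; apply/CP; split=> //.
    have -> : y - t = (x - t) + a - b.
      by rewrite [x - t + a]addrAC e [y + b - t]addrAC addrK.
    by apply: (subgroupB gN _ (AN _ bA)); apply: (subgroupD gN xt (AN _ aA)).
  by have := fsubset_leq_card CT; lia.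
have stabR a : a \in A -> fshift a R = R.
  by move=> aA; apply: fshift_eq => x xR; rewrite -RA addrC mem_fsum.
have stabN x : N x -> fshift x R = R.
  by apply: (gen_subgroup_min (subgroup_fstab R)).
(* A non-empty [R] is stabilised by [N] while the rest of [T] lies in one coset of [N]. If [R] is
   empty, [T] lies in [t + N], which contains [0], so [N] is all of [K]. *)
case: (eqVneq R fset0) => [R0|Rn0]; last first.
  case: (no_fragment_coset (K := K) (T := T) (R := R) (d := d) (t := t)) => //.
  - by rewrite defR fsubsetDl.
  - exact: stabR.
  - by apply/fsetDP; split=> //; rewrite defR; apply/negP => /fsetDP[_ /negP].
  move=> x /fsetDP[xT /negP xR]; apply: stabN.
  have /CP[] // : x \in C.
  by apply: contrapT => /negP xC; apply: xR; rewrite defR; apply/fsetDP.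
have TC : T = C.
  by apply/eqP; rewrite eqEfsubset CT andbT -fsetD_eq0 -defR; apply/eqP.
have Nt : N t.
  have := T0; rewrite TC => /CP[_]; rewrite sub0r => /(subgroupN gN).
  by rewrite opprK.
have TN : fincl T N.
  by move=> x; rewrite TC => /CP[_ /(subgroupD gN Nt)]; rewrite addrC subrK.
have KN x : K x -> N x by apply: Tgen.
have iKA : isoperimetric K A.
  move=> Y [Y0 YK [y /KN Ny yA]]; apply: iN; split=> //; last by exists y.
  by move=> z /YK/KN.
have admTA : admissible_fset K A T.
  by split=> //; [apply/fset0Pn; exists 0 | rewrite fsumC].
exfalso; apply: (sidon_no_fragment gK A0 _ sA A3 iKA admTA T1).
- by move=> L gL AL x /KN; apply: gen_subgroup_min.
- by rewrite fsumC cA addnC.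
(* Since |A| <= |T|, the size 3|T| - 2 suffices for the two-atoms of [A]. *)
by apply: size_geW Kbig; clear - AT T1; lia.
Qed.

(** * Iterated sums *)

Lemma fksumS k A : fksum k.+1 A = A `+` fksum k A. Proof. by []. Qed.

Lemma fksum1 A : fksum 1 A = A. Proof. by rewrite fksumS fsumC fsum0s. Qed.

Lemma fksum_neq0 k A : A != fset0 -> fksum k A != fset0.
Proof.
case/fset0Pn=> a aA; apply/fset0Pn; exists (a *+ k).
by elim: k => [|k IHk]; [rewrite inE mulr0n | rewrite mulrS mem_fsum].
Qed.

Lemma mulrn_fksum k A x : x \in A -> x *+ k \in fksum k A.
Proof.
move=> xA; elim: k => [|k IHk]; first by rewrite inE mulr0n.
by rewrite mulrS mem_fsum.
Qed.

Lemma fincl_fksum K k A : subgroup K -> fincl A K -> fincl (fksum k A) K.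
Proof.
move=> gK AK; elim: k => [|k IHk]; last exact: fincl_fsum.
by move=> x; rewrite inE => /eqP->; apply: (subgroup0 gK).
Qed.

Lemma fksum_mono m n A : 0 \in A -> (m <= n)%N -> fksum m A `<=` fksum n A.
Proof.
move=> A0 /subnK <-; elim: (n - m)%N => // k IHk.
by apply: fsubset_trans IHk _; rewrite addSn fksumS fsumC fsum_subl.
Qed.

Lemma fksum_fshift k x A : fksum k (fshift x A) = fshift (x *+ k) (fksum k A).
Proof.
elim: k => [|k IHk]; first by rewrite mulr0n fshift0.
by rewrite !fksumS IHk fsum_fshift fsumC fsum_fshift fshiftD -mulrS fsumC.
Qed.

(** A sum of [k.+1] terms either takes all of them from [A] or has one in [B]. *)
Lemma fksumU k A B :
  fksum k.+1 (A `|` B) = fksum k.+1 A `|` (B `+` fksum k (A `|` B)).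
Proof.
elim: k => [|k IHk].
  by rewrite !fksum1 fsumC fsum0s.
rewrite [in LHS]fksumS fsumUl {1}IHk (fksumS k.+1 A) [A `+` (_ `|` _)]fsumC fsumUl.
rewrite -!fsetUA fsumC; congr (_ `|` _); apply/fsetUidPr.
rewrite -fsumA; apply: fsumS => //; rewrite fksumS fsumC; apply: fsumS => //.
exact: fsubsetUl.
Qed.

(** Recording every increment, not only the total, allows equality at [k] to be passed down to
    smaller multiples. *)
Definition steps k A :=
  forall i, (i < k)%N -> (#|` fksum i A| + #|` A| <= (#|` fksum i.+1 A|).+1)%N.

Lemma card_fksum0 A : #|` fksum 0 A| = 1%N. Proof. exact: cardfs1. Qed.

Lemma leq_card_fksum k A : steps k A -> (k * #|` A| + 1 <= #|` fksum k A| + k)%N.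
Proof.
elim: k => [|k IHk] st; first by rewrite card_fksum0.
have := IHk (fun i ik => st i (ltnW ik)); have := st k (ltnSn k).
by rewrite mulSn; clear; lia.
Qed.

Lemma card_fksum_eq k A i : steps k A -> (i <= k)%N ->
    (#|` fksum k A| + k <= k * #|` A| + 1)%N ->
  (#|` fksum i A| + i)%N = (i * #|` A| + 1)%N.
Proof.
elim: k => [|k IHk] st ik cA.
  by move: ik; rewrite leqn0 => /eqP ->; rewrite card_fksum0.
have stk : steps k A by move=> j jk; apply/st/ltnW.
have := leq_card_fksum stk; have := st k (ltnSn k).
move: ik; rewrite leq_eqVlt => /predU1P[->|ik].
  by have := leq_card_fksum st; clear - cA; lia.
move=> e1 e2; apply: IHk => //.
by move: cA; rewrite mulSn; clear - e1 e2; lia.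
Qed.

Section Steps.
Variables (K : set G) (T : {fset G}).
Hypotheses (gK : subgroup K) (T0 : 0 \in T) (TK : fincl T K).
Hypothesis iT : isoperimetric K T.

(** The multiples of [T] increase because [0] is in [T], so all of them up to [k] miss the same
    point of [K]. *)
Lemma steps_of_misses k : misses K (fksum k T) -> steps k T.
Proof.
move=> mk i ik; rewrite fksumS fsumC; apply: iT; split.
- by apply: fksum_neq0; apply/fset0Pn; exists 0.
- exact: fincl_fksum.
by rewrite fsumC -fksumS; apply: missesS mk; apply: fksum_mono.
Qed.

(** If (k+1)T misses a point of [K], [steps_of_misses] applies. Otherwise it is [K], and kT avoids
    the |T| - 1 points (k+1)t - y with [y] in [T] other than [t]. This gives the last increment and,
    as kT misses a point, the earlier ones. *)
Lemma steps_of_unique k t : (1 < #|` T|)%N -> t \in T ->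
  t *+ k.+1 \notin (T `\ t) `+` fksum k T -> steps k.+1 T.
Proof.
move=> T1 tT tk.
have [t' t'T tt'] := card_gt1_neq t T1.
have [|full] := pselect (misses K (fksum k.+1 T)); first exact: steps_of_misses.
have {full}full := not_misses full.
have tK x : x \in T -> K (t *+ k.+1 - x).
  move=> xT; apply: (subgroupB gK _ (TK xT)).
  by apply: (fincl_fksum gK TK (k := k.+1)); apply: mulrn_fksum.
pose D := fshift (t *+ k.+1) (fopp (T `\ t)).
have DP x : x \in D -> exists2 y, y \in T `\ t & x = t *+ k.+1 - y.
  rewrite in_fshift in_fopp => xD; exists (- (x - t *+ k.+1)) => //.
  by rewrite opprK addrC subrK.
have disj x : x \in fksum k T -> x \notin D.
  move=> xk; apply: contra tk => /DP[y yT xE].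
  by rewrite -(subrK y (t *+ k.+1)) -xE addrC mem_fsum.
move=> i; rewrite ltnS leq_eqVlt => /predU1P[->|ik]; last first.
  apply: steps_of_misses ik; exists (t *+ k.+1 - t'); first exact: tK.
  apply: contra tk => h; rewrite -(subrK t' (t *+ k.+1)) addrC mem_fsum //.
  by rewrite !inE tt'.
have : (#|` fksum k T `|` D| <= #|` fksum k.+1 T|)%N.
  apply/fsubset_leq_card/fsubsetP => x; rewrite in_fsetU => /orP[xk|/DP[y yT ->]].
    by apply: (fsubsetP (fksum_mono T0 (leqnSn k))).
  by apply/full/tK; move: yT; rewrite !inE => /andP[].
rewrite card_fsetU_disj // card_fshift card_fopp.
by have := cardfsD1 t T; rewrite tT; clear; lia.
Qed.

End Steps.

(** * Aperiodic sets *)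

Definition faperiodic A := forall x, fshift x A = A -> x = 0.

Lemma faperiodic_fshift x A : faperiodic A -> faperiodic (fshift x A).
Proof.
move=> apA y yA; apply: apA; apply/fsetP => z.
have := mem_fshift x A z; rewrite -yA in_fshift => <-.
by rewrite -addrA mem_fshift in_fshift.
Qed.

(** If kA were all of [K], every element of [A] would be a period of it. *)
Lemma misses_fksum K k A : subgroup K -> 0 \in A -> fincl A K ->
  faperiodic (fksum k A) -> (1 < #|` A|)%N -> misses K (fksum k A).
Proof.
move=> gK A0 AK apA A1; have [a aA a0] := card_gt1_neq 0 A1.
apply: contrapT => /not_misses full; case/eqP: a0; apply: apA.
apply: fshift_eq => x xk; apply: full; apply: (subgroupD gK (AK _ aA)).
exact: fincl_fksum xk.
Qed.

End FiniteSets.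

(** * Passing to the quotient *)

Lemma quot_map_is_zmod_morphism (G : zmodType) (H : zmodClosed G) :
  zmod_morphism (quot_map H).
Proof. by move=> x y; rewrite /quot_map raddfB. Qed.

HB.instance Definition _ (G : zmodType) (H : zmodClosed G) :=
  GRing.isZmodMorphism.Build G (Quotient.quot H) (quot_map H)
    (quot_map_is_zmod_morphism H).

Lemma quot_map_eq0 (G : zmodType) (H : zmodClosed G) x :
  (quot_map H x == 0) = (x \in H).
Proof. by rewrite -(raddf0 (quot_map H)) -Quotient.idealrBE subr0. Qed.

Lemma exists_zmodClosed (G : zmodType) (P : {fset G}) : subgroup [set` P] ->
  exists H : zmodClosed G, forall x, (x \in H) = (x \in P).
Proof.
move=> [P0 PB]; have cP : zmod_closed (mem P) by split.
pose B := GRing.isZmodClosed.Build G (mem P) cP.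
by exists (HB.pack (mem P : {pred G}) B : zmodClosed G).
Qed.

Section Quotient.
Variables (G G' : zmodType) (f : {additive G -> G'}) (H : {fset G}).
Hypothesis kerf : forall x, (f x == 0) = (x \in H).
Implicit Types (A B S X Y L : {fset G}) (K : set G).

Local Notation "A `+` B" := (fsum A B) : fset_scope.

Definition fimage A : {fset G'} := [fset f x | x in A].

Lemma fimageP A y : reflect (exists2 x, x \in A & y = f x) (y \in fimage A).
Proof. exact: imfsetP. Qed.

Lemma mem_fimage A x : x \in A -> f x \in fimage A.
Proof. by move=> xA; apply/fimageP; exists x. Qed.

Lemma eq_fimage x y : (f x == f y) = (x - y \in H).
Proof. by rewrite -kerf raddfB subr_eq0. Qed.

Lemma ker_subgroup : subgroup [set` H].
Proof.
split=> [|x y] /=; first by rewrite -kerf raddf0.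
by rewrite -!kerf raddfB => /eqP-> /eqP->; rewrite subrr.
Qed.

Lemma ker0 : 0 \in H. Proof. exact: (subgroup0 ker_subgroup). Qed.

Lemma card_ker_gt0 : (0 < #|` H|)%N.
Proof. by rewrite cardfs_gt0; apply/fset0Pn; exists 0; apply: ker0. Qed.

Lemma fimage_fsum A B : fimage (A `+` B) = fimage A `+` fimage B.
Proof.
apply/fsetP=> z; apply/fimageP/fsumP.
  move=> [_ /fsumP[x [y [xA yB ->]]] ->]; exists (f x), (f y).
  by rewrite raddfD !mem_fimage.
move=> [_ [_ [/fimageP[x xA ->] /fimageP[y yB ->] ->]]].
by exists (x + y); rewrite ?raddfD ?mem_fsum.
Qed.

Lemma fimage_fksum k A : fimage (fksum k A) = fksum k (fimage A).
Proof.
elim: k => [|k IHk]; last by rewrite !fksumS fimage_fsum IHk.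
apply/fsetP=> z; rewrite inE; apply/fimageP/eqP => [[x /[!inE]/eqP-> ->]|->].
  by rewrite raddf0.
by exists 0; rewrite ?inE ?raddf0.
Qed.

Lemma mem_fsum_ker A x : (x \in A `+` H) = (f x \in fimage A).
Proof.
apply/fsumP/fimageP => [[y [h [yA hH ->]]]|[y yA /eqP]].
  by exists y => //; rewrite raddfD; move: hH; rewrite -kerf => /eqP->; rewrite addr0.
by rewrite eq_fimage => xyH; exists y, (x - y); rewrite [y + _]addrC subrK.
Qed.

(** The induction removes one fibre of [f] at a time, each contributing a full coset of [H]. *)
Lemma card_fsum_ker A : #|` A `+` H| = (#|` fimage A| * #|` H|)%N.
Proof.
have [n] := ubnP #|` A|; elim: n => // n IHn in A *; rewrite ltnS => An.
case: (fset_0Vmem A) => [->|[a aA]].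
  have -> : fset0 `+` H = fset0.
    by apply/fsetP=> x; rewrite inE; apply/fsumP => -[y [z []]].
  have -> : fimage fset0 = fset0.
    by apply/fsetP=> x; rewrite inE; apply/fimageP => -[].
  by rewrite !cardfs0.
pose B : {fset G} := [fset x in A | f x != f a].
have BP x : (x \in B) = (x \in A) && (f x != f a) by rewrite !inE.
have BA : B `<=` A by apply/fsubsetP => x; rewrite BP => /andP[].
have BnA : (#|` B| < #|` A|)%N.
  apply: fproper_ltn_card; rewrite fproperE BA /=; apply/fsubsetPn; exists a => //.
  by rewrite BP eqxx andbF.
have -> : A `+` H = (B `+` H) `|` fshift a H.
  apply/fsetP=> x; rewrite in_fsetU !mem_fsum_ker in_fshift -eq_fimage.
  apply/fimageP/orP => [[y yA xy]|[/fimageP[y yB xy]|/eqP xa]].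
  - case: (eqVneq (f y) (f a)) => fya; first by right; rewrite xy fya.
    by left; rewrite xy mem_fimage // BP yA.
  - by exists y => //; apply: (fsubsetP BA).
  - by exists a.
have -> : fimage A = f a |` fimage B.
  apply/fsetP=> x; rewrite in_fset1U; apply/fimageP/orP.
    move=> [y yA ->]; case: (eqVneq (f y) (f a)) => fya; first by left.
    by right; rewrite mem_fimage // BP yA.
  move=> [/eqP->|/fimageP[y yB ->]]; first by exists a.
  by exists y => //; apply: (fsubsetP BA).
have faB : f a \notin fimage B.
  by apply/negP => /fimageP[y]; rewrite BP => /andP[_ /eqP ne] e; apply: ne.
rewrite cardfsU1 faB card_fsetU_disj.
  by rewrite IHn ?(leq_trans BnA) // card_fshift mulnDl mul1n addnC.
move=> x; rewrite mem_fsum_ker in_fshift -eq_fimage => xB.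
by apply: contra faB => /eqP<-.
Qed.

Lemma card_fperiodic A : A `+` H = A -> #|` A| = (#|` fimage A| * #|` H|)%N.
Proof. by rewrite -card_fsum_ker => ->. Qed.

Lemma exists_lift K (Y : {fset G'}) : fincl Y (f @` K)%classic ->
  exists2 X, fincl X K & fimage X = Y.
Proof.
move=> YK; pose s y := xget 0 [set x | K x /\ f x = y].
have sP y : y \in Y -> K (s y) /\ f (s y) = y.
  by move=> /YK[x Kx fxy]; apply: (@xgetPex _ 0 [set x | K x /\ f x = y]); exists x.
pose X : {fset G} := [fset s y | y in Y].
exists X; first by move=> _ /imfsetP[y /= /sP[? _] ->].
apply/fsetP=> z; apply/fimageP/idP => [[_ /imfsetP[y /= yY ->] ->]|zY].
  by rewrite (sP _ yY).2.
by exists (s z); rewrite ?(sP _ zY).2 //; apply/imfsetP; exists z.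
Qed.

Lemma subgroup_image K : subgroup K -> subgroup (f @` K)%classic.
Proof.
move=> gK; split; first by exists 0; [apply: (subgroup0 gK) | rewrite raddf0].
move=> _ _ [x Kx <-] [y Ky <-]; exists (x - y); last by rewrite raddfB.
exact: (subgroupB gK).
Qed.

Lemma fincl_fimage K A : fincl A K -> fincl (fimage A) (f @` K)%classic.
Proof. by move=> AK _ /fimageP[x /AK Kx ->]; exists x. Qed.

Lemma misses_image K A :
  misses K (A `+` H) -> misses (f @` K)%classic (fimage A).
Proof. by move=> [y Ky]; rewrite mem_fsum_ker => yA; exists (f y) => //; exists y. Qed.

Lemma misses_of_image K A :
  misses (f @` K)%classic (fimage A) -> misses K (A `+` H).
Proof. by move=> [_ [y Ky <-] yA]; exists y; rewrite ?mem_fsum_ker. Qed.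

(** * Fragments and the quotient map *)

Section Fragment.
Variables (K : set G) (S : {fset G}).
Hypotheses (gK : subgroup K) (HK : fincl H K).
Hypothesis Hmin : forall X, admissible_fset K S X ->
  (#|` H `+` S| + #|` X| <= #|` X `+` S| + #|` H|)%N.

Lemma admissible_lift (Y : {fset G'}) X : fincl X K -> fimage X = Y ->
    admissible_fset (f @` K)%classic (fimage S) Y ->
  admissible_fset K S (X `+` H).
Proof.
move=> XK XY [Y0 YK mY]; split.
- have /fset0Pn[y] := Y0; rewrite -XY => /fimageP[x xX _].
  by apply/fset0Pn; exists x; rewrite mem_fsum_ker mem_fimage.
- exact: fincl_fsum.
rewrite -fsumA [H `+` S]fsumC fsumA; apply: misses_of_image.
by rewrite fimage_fsum XY.
Qed.

Lemma card_fsum_kerA X :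
  #|` (X `+` H) `+` S| = (#|` fimage X `+` fimage S| * #|` H|)%N.
Proof. by rewrite -fsumA [H `+` S]fsumC fsumA card_fsum_ker fimage_fsum. Qed.

(** Compare [H] with the preimage [X + H] of [Y]: all four cardinalities are multiples of |H|, which
    can be cancelled. *)
Lemma isoperimetric_image : isoperimetric (f @` K)%classic (fimage S).
Proof.
move=> Y admY; have [_ YK _] := admY.
have [X XK XY] := exists_lift YK.
have := Hmin (admissible_lift XK XY admY).
rewrite card_fsum_kerA [H `+` S]fsumC !card_fsum_ker XY -mulnDl -mulSnr.
by rewrite leq_pmul2r ?card_ker_gt0 // addnC.
Qed.

(** The preimage of a subgroup violating the bound is a subgroup containing [H] that does at least
    as well as [H], hence equals [H] by maximality; its image is then trivial. *)
Lemma no_subgroup_fragment_image :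
  (forall L, subgroup [set` L] -> admissible_fset K S L -> H `<=` L ->
    (#|` L `+` S| + #|` H| <= #|` H `+` S| + #|` L|)%N -> L = H) ->
  no_subgroup_fragment (f @` K)%classic (fimage S).
Proof.
move=> Hmax L' gL' admL' L'1; have [_ L'K _] := admL'.
have [X XK XL'] := exists_lift L'K.
have admL := admissible_lift XK XL' admL'.
rewrite leqNgt; apply/negP => cL'.
have XH : X `+` H = H.
  apply: Hmax => //.
  - split=> [|x y]; rewrite /= !mem_fsum_ker XL' ?raddf0 ?raddfB.
      exact: (subgroup0 gL').
    exact: (subgroupB gL').
  - apply/fsubsetP => x; rewrite mem_fsum_ker XL' -kerf => /eqP->.
    exact: (subgroup0 gL').
  rewrite card_fsum_kerA [H `+` S]fsumC !card_fsum_ker XL' -mulnDl -mulSnr.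
  by rewrite leq_pmul2r ?card_ker_gt0 // addnC.
have := card_fsum_ker X; rewrite XH XL'; have := card_ker_gt0.
by clear - L'1; nia.
Qed.

End Fragment.

(** * Components and the shape of the multiples of [S] *)

Definition fcomp S x : {fset G} := [fset y in S | f y == f x].

Lemma in_fcomp S x y : (y \in fcomp S x) = (y \in S) && (f y == f x).
Proof. by rewrite !inE. Qed.

Lemma fcompE S x : fcomp S x = fshift x H `&` S.
Proof. by apply/fsetP=> y; rewrite in_fcomp in_fsetI in_fshift -eq_fimage andbC. Qed.

Lemma fcomp_sub S x : fcomp S x `<=` S.
Proof. by apply/fsubsetP => y; rewrite in_fcomp => /andP[]. Qed.

(** Pigeonhole: [fcomp S x] and [z - fcomp S y] lie in the same coset of [H] and have together more
    than |H| elements, so they meet. *)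
Lemma mem_fsum_fcomp S x y z : f z = f x + f y ->
  (#|` H| < #|` fcomp S x| + #|` fcomp S y|)%N ->
  z \in fcomp S x `+` fcomp S y.
Proof.
move=> fz cH; pose B := fshift z (fopp (fcomp S y)).
have BP b : (b \in B) = (z - b \in fcomp S y).
  by rewrite in_fshift in_fopp opprB.
have BU : (#|` fcomp S x `|` B| <= #|` H|)%N.
  rewrite -(card_fshift x H); apply/fsubset_leq_card/fsubsetP => b.
  rewrite in_fsetU BP !in_fcomp in_fshift -eq_fimage => /orP[]/andP[_ //].
  by rewrite raddfB fz subr_eq addrC (inj_eq (addrI _)) eq_sym.
have /fset0Pn[b] : fcomp S x `&` B != fset0.
  rewrite -cardfs_gt0; have := cardfsUI (fcomp S x) B.
  have : #|` B| = #|` fcomp S y| by rewrite card_fshift card_fopp.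
  by move: cH BU; clear; lia.
rewrite in_fsetI BP => /andP[bx zb].
by rewrite -(subrK b z) addrC mem_fsum.
Qed.

Section Structure.
Variables (S : {fset G}) (s0 : G).
Hypotheses (s0S : s0 \in S) (holes : ((#|` H `+` S|).+1 <= #|` H| + #|` S|)%N).
Hypothesis S0min : {in S, forall x, (#|` fcomp S s0| <= #|` fcomp S x|)%N}.

Let S0 := fcomp S s0.
Let S' := S `\` S0.
Let T := fimage S.

(** By [holes], at most |H| - 1 of the 2|H| points of the two cosets are outside [S]. *)
Lemma card_two_fcomp x y : x \in S -> y \in S -> f x != f y ->
  (#|` H| < #|` fcomp S x| + #|` fcomp S y|)%N.
Proof.
move=> xS yS fxy.
have Hsh z : #|` fshift z H `\` S| = (#|` H| - #|` fcomp S z|)%N.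
  by rewrite cardfsD card_fshift fcompE.
have cle z : (#|` fcomp S z| <= #|` H|)%N.
  by rewrite -(card_fshift z H) fcompE; apply/fsubset_leq_card/fsubsetIl.
have : (#|` (fshift x H `\` S) `|` (fshift y H `\` S)| <= #|` (H `+` S) `\` S|)%N.
  apply/fsubset_leq_card; rewrite -fsetDUl fsetSD // fsubUset fsumC.
  by rewrite !fshift_sub_fsum.
rewrite [X in (_ <= X)%N]cardfsDS; last by rewrite fsumC fsum_subl ?ker0.
rewrite card_fsetU_disj; last first.
  move=> z; rewrite !in_fsetD !in_fshift -!eq_fimage => /andP[_ /eqP zx].
  by rewrite negb_and zx fxy orbT.
rewrite !Hsh; have := cle x; have := cle y; have := card_ker_gt0.
by move: holes; clear; lia.
Qed.

Lemma in_rest x : (x \in S') = (x \in S) && (f x != f s0).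
Proof. by rewrite in_fsetD in_fcomp; case: (x \in S); rewrite ?andbF ?andbT. Qed.

(** By [mem_fsum_fcomp], a component other than [S0] plus any component is a full coset of [H]. *)
Lemma rest_periodic : (S' `+` S) `+` H = S' `+` S.
Proof.
apply/eqP; rewrite eq_sym eqEfsubset fsum_subl ?ker0 // andTb.
apply/fsubsetP => z; rewrite mem_fsum_ker => /fimageP[_ /fsumP[a [b [aS' bS ->]]]].
rewrite raddfD => fz; have := aS'; rewrite in_rest => /andP[aS fa].
have ca : fcomp S a `<=` S'.
  by apply/fsubsetP => y; rewrite in_fcomp in_rest => /andP[-> /eqP->].
apply: (fsubsetP (fsumS ca (fcomp_sub S b))); apply: mem_fsum_fcomp => //.
case: (eqVneq (f a) (f b)) => fab; last exact: card_two_fcomp.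
(* For a component added to itself: it is at least as large as [S0], so twice its size exceeds |H|
   too. *)
have <- : fcomp S a = fcomp S b by apply/fsetP => y; rewrite !in_fcomp fab.
have := card_two_fcomp aS s0S fa; have := S0min aS.
by clear; lia.
Qed.

Lemma fimage_rest : fimage S' = T `\ f s0.
Proof.
apply/fsetP=> y; rewrite in_fsetD1; apply/fimageP/andP.
  by move=> [x]; rewrite in_rest => /andP[xS fx] ->; rewrite mem_fimage.
by move=> [ys /fimageP[x xS yx]]; exists x; rewrite // in_rest xS -yx.
Qed.

Lemma fimage_fksum_fcomp k x : x \in fksum k S0 -> f x = f s0 *+ k.
Proof.
elim: k x => [|k IHk] x; first by rewrite inE => /eqP->; rewrite raddf0.
case/fsumP=> y [z [yS zk ->]]; rewrite raddfD (IHk _ zk) mulrS.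
by move: yS; rewrite in_fcomp => /andP[_ /eqP->].
Qed.

Lemma setU_rest : S0 `|` S' = S.
Proof. by rewrite fsetUDl fsetDv fsetD0; apply/fsetUidPr/fcomp_sub. Qed.

Lemma card_rest : (#|` S| = #|` S0| + #|` S'|)%N.
Proof.
rewrite -{1}setU_rest card_fsetU_disj // => x xS0.
by rewrite in_fsetD xS0.
Qed.

Lemma card_rest_ker : (#|` S' `+` H| + #|` H| = #|` T| * #|` H|)%N.
Proof.
rewrite card_fsum_ker fimage_rest -mulSnr; congr (_ * _)%N.
by rewrite (cardfsD1 (f s0) T) mem_fimage.
Qed.

Section Sums.
Variable k : nat.
Let F := S' `+` fksum k.+1 S.
Hypotheses (H1 : (1 < #|` H|)%N) (kS_aper : faperiodic (fksum k.+2 S)).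

Lemma fksum_structure : fksum k.+2 S = fksum k.+2 S0 `|` F.
Proof. by have := fksumU k.+1 S0 S'; rewrite setU_rest. Qed.

(** At least one summand [S] accompanies [S'], so [rest_periodic] applies; hence the [k.+2] summands
    of the whole sum. *)
Lemma F_periodic : F `+` H = F.
Proof.
by rewrite /F fksumS fsumA -fsumA [_ `+` H]fsumC fsumA rest_periodic.
Qed.

Lemma mem_F x : (x \in F) = (f x \in fimage F).
Proof. by rewrite -mem_fsum_ker F_periodic. Qed.

Lemma F_fshift h : h \in H -> fshift h F = F.
Proof.
by move=> hH; apply: fshift_eq => x xF; rewrite -F_periodic addrC mem_fsum.
Qed.

Lemma fimage_F : fimage F = (T `\ f s0) `+` fksum k.+1 T.
Proof. by rewrite fimage_fsum fimage_rest fimage_fksum. Qed.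

(** Otherwise the coset containing [fksum k.+2 S0] would lie in [F], so the whole sum would be [F],
    which has the nonzero elements of [H] as periods. *)
Lemma fksum_unique : f s0 *+ k.+2 \notin (T `\ f s0) `+` fksum k.+1 T.
Proof.
rewrite -fimage_F; apply/negP => s0F; have [h hH h0] := card_gt1_neq 0 H1.
case/eqP: h0; apply: kS_aper; rewrite fksum_structure.
have /fsetUidPr -> : fksum k.+2 S0 `<=` F; last exact: F_fshift.
by apply/fsubsetP => x /fimage_fksum_fcomp fx; rewrite mem_F fx.
Qed.

Lemma fksum_fcomp_notin x : x \in fksum k.+2 S0 -> x \notin F.
Proof.
by move=> /fimage_fksum_fcomp fx; rewrite mem_F fx fimage_F fksum_unique.
Qed.

(** The sum is the disjoint union of [fksum k.+2 S0] and [F], and [F] consists of the cosets of [H]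
    over all elements of [fksum k.+2 T] but one. *)
Lemma card_fksum_structure : (#|` fksum k.+2 S| + #|` H| =
  #|` fksum k.+2 T| * #|` H| + #|` fksum k.+2 S0|)%N.
Proof.
have s0S0 : s0 \in S0 by rewrite in_fcomp s0S eqxx.
have -> : fksum k.+2 T = f s0 *+ k.+2 |` fimage F.
  rewrite -fimage_fksum fksum_structure; apply/fsetP => y.
  rewrite in_fset1U; apply/fimageP/orP => [[x /fsetUP[xS0|xF] ->]|[/eqP->|]].
  - by left; rewrite (fimage_fksum_fcomp xS0).
  - by right; rewrite mem_fimage.
  - exists (s0 *+ k.+2); last by rewrite raddfMn.
    by rewrite in_fsetU mulrn_fksum.
  by move/fimageP=> [x xF ->]; exists x; rewrite // in_fsetU xF orbT.
rewrite cardfsU1 fimage_F fksum_unique -fimage_F fksum_structure.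
rewrite (card_fsetU_disj fksum_fcomp_notin) (card_fperiodic F_periodic).
by rewrite mulnDl mul1n -addnA [RHS]addnC [X in (_ + X)%N]addnC.
Qed.

(** This sum lies in one coset of [H], so its periods belong to [H]; they fix [F] too, hence the
    whole sum. *)
Lemma faperiodic_fksum_fcomp : faperiodic (fksum k.+2 S0).
Proof.
move=> x xS0.
have s0S0 : s0 \in S0 by rewrite in_fcomp s0S eqxx.
have xs0 : x + s0 *+ k.+2 \in fksum k.+2 S0 by rewrite -xS0 mem_fshift mulrn_fksum.
have xH : x \in H.
  rewrite -kerf; have /eqP := fimage_fksum_fcomp xs0.
  by rewrite raddfD raddfMn -subr_eq0 addrK.
apply: kS_aper; rewrite fksum_structure.
have -> : fshift x (fksum k.+2 S0 `|` F) = fshift x (fksum k.+2 S0) `|` fshift x F.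
  by apply/fsetP=> y; rewrite !(in_fsetU, in_fshift).
by rewrite xS0 F_fshift.
Qed.

End Sums.
End Structure.

Lemma card_fimage_gt1 K S : subgroup K -> 0 \in S ->
    (forall L : set G, subgroup L -> fincl S L -> forall x, K x -> L x) ->
    misses K (H `+` S) -> (1 < #|` fimage S|)%N.
Proof.
move=> gK S0 Sgen [y Ky yHS].
have [x xS xH] : exists2 x, x \in S & x \notin H.
  apply: contrapT => /forall2NP SH; case/negP: yHS.
  apply: (fsubsetP (fsum_subl H S0)); apply: (Sgen _ ker_subgroup _ _ Ky).
  by move=> x xS; have [|/negP] := SH x => //; case/negPn.
apply: (card_fset_gt1 (mem_fimage S0) (mem_fimage xS)).
by rewrite raddf0 eq_sym kerf.
Qed.

End Quotient.

(* Here u = |T|, h = |H|, s = |S|, s' = |S \ S_0|, p = |(S \ S_0) + H|,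
   and nS, nT, nS0 are the sizes of the k-fold sums. *)
Lemma structure_leq (k u h s s0 s' p nS nT nS0 : nat) : (0 < h)%N ->
  (k * u + 1 <= nT + k)%N -> (nS + h = nT * h + nS0)%N -> (s = s0 + s')%N ->
  (s' <= p)%N -> (p + h = u * h)%N -> (k * s0 + 1 <= nS0 + k)%N ->
  (k * s + 1 <= nS + k)%N.
Proof.
move=> h0 cT cS -> s'p pu cS0; have : (k * s' <= k * p)%N by rewrite leq_mul2l s'p orbT.
have : ((k * u + 1) * h <= (nT + k) * h)%N by rewrite leq_mul2r cT orbT.
have : (k * (p + h) = k * (u * h))%N by rewrite pu.
by rewrite !mulnDl !mulnDr mulnA; lia.
Qed.

(** The bound of [structure_leq] adds up three inequalities with positive weights, so equality in it
    makes all three tight. *)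
Lemma structure_eq (k u h s s0 s' p nS nT nS0 : nat) : (0 < k)%N -> (0 < h)%N ->
  (k * u + 1 <= nT + k)%N -> (nS + h = nT * h + nS0)%N -> (s = s0 + s')%N ->
  (s' <= p)%N -> (p + h = u * h)%N -> (k * s0 + 1 <= nS0 + k)%N ->
  (nS + k = k * s + 1)%N ->
  [/\ (p <= s')%N, (nS0 + k = k * s0 + 1)%N & (nT + k <= k * u + 1)%N].
Proof.
move=> k0 h0 cT cS -> s'p pu cS0.
have : (k * s' <= k * p)%N by rewrite leq_mul2l s'p orbT.
have : ((k * u + 1) * h <= (nT + k) * h)%N by rewrite leq_mul2r cT orbT.
have : (k * (p + h) = k * (u * h))%N by rewrite pu.
rewrite !mulnDl !mulnDr mulnA => e1 e2 e3 e4; split.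
- by rewrite -(leq_pmul2l k0); lia.
- by lia.
by rewrite -(leq_pmul2r h0) !mulnDl; lia.
Qed.

(* A non-trivial subgroup fragment of S reduces the claim to the smallest
   component of S, which is a proper subset. *)
Lemma kneser_fksum (G : zmodType) (k : nat) (S : {fset G}) :
  S != fset0 -> faperiodic (fksum k S) ->
  (k * #|` S| + 1 <= #|` fksum k S| + k)%N.
Proof.
case: k => [|[|k]]; first by rewrite card_fksum0.
  by rewrite fksum1 mul1n.
have [n] := ubnP #|` S|; elim: n => // n IHn in S *; rewrite ltnS => Sn Sn0.
have /fset0Pn[a aS] := Sn0.
rewrite -(card_fshift (- a) S) -(card_fshift (- a *+ k.+2) (fksum k.+2 S)) -fksum_fshift.
move=> /(faperiodic_fshift (x := - a *+ k.+2)); rewrite -fksum_fshift.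
rewrite -(card_fshift (- a) S) in Sn.
have : 0 \in fshift (- a) S by rewrite in_fshift opprK add0r.
move: (fshift (- a) S) Sn => {a aS Sn0}S Sn S0 apS.
have Sn0 : S != fset0 by apply/fset0Pn; exists 0.
have [S1|S1] := leqP #|` S| 1.
  have : (0 < #|` fksum k.+2 S|)%N by rewrite cardfs_gt0; apply: fksum_neq0.
  by move: S1; clear; nia.
pose K := gen_subgroup [set` S].
have gK : subgroup K := subgroup_gen _.
have SK : fincl S K by move=> x xS; apply: gen_subgroup_sub.
have mkS : misses K (fksum k.+2 S) by apply: misses_fksum.
have adm0 : admissible_fset K S [fset 0].
  split; first by apply/fset0Pn; exists 0; rewrite inE.
    by move=> x; rewrite inE => /eqP->; apply: (subgroup0 gK).
  by rewrite fsum0s; apply: missesS mkS; rewrite -{1}(fksum1 S) fksum_mono.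
have [P [gP [Pn0 PK mP] Pmin]] := exists_subgroup_fragment gK S0 SK adm0.
have holes : ((#|` fsum P S|).+1 <= #|` P| + #|` S|)%N.
  by have := Pmin _ adm0; rewrite fsum0s cardfs1 addn1 addnC.
have [P1|P1] := leqP #|` P| 1.
  apply: leq_card_fksum; apply: (steps_of_misses gK S0 SK _ mkS) => X /Pmin.
  have := leq_card_fsuml S Pn0; rewrite fsumC.
  by move: P1; clear; lia.
have [H HP] := exists_zmodClosed gP.
have kerf x : (quot_map H x == 0) = (x \in P) by rewrite quot_map_eq0 HP.
pose f : {additive G -> Quotient.quot H} := quot_map H.
have [s0 s0S s0min] := @exists_minimal _ (fun x => #|` fcomp f S x|)
  (fun x => x \in S) (ex_intro _ 0 S0).
have T1 : (1 < #|` fimage f S|)%N.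
  by apply: (card_fimage_gt1 kerf gK) => // L gL SL x; apply: gen_subgroup_min.
have st : steps k.+2 (fimage f S).
  apply: (@steps_of_unique _ (f @` K)%classic _ _ _ _ _ _ (f s0)).
  - exact: subgroup_image.
  - by rewrite -(raddf0 f) mem_fimage.
  - exact: fincl_fimage.
  - exact: (isoperimetric_image kerf gK PK Pmin).
  - exact: T1.
  - exact: mem_fimage.
  - exact: (fksum_unique kerf s0S holes s0min P1 apS).
have apS0 := faperiodic_fksum_fcomp kerf s0S holes s0min apS.
have s0S0 : s0 \in fcomp f S s0 by rewrite in_fcomp s0S eqxx.
have cS0 := card_rest f S s0; have cS' := card_rest_ker kerf s0S.
have cS'0 : (0 < #|` S `\` fcomp f S s0|)%N.
  have [_ /fimageP[x xS ->] xs0] := card_gt1_neq (f s0) T1.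
  by rewrite cardfs_gt0; apply/fset0Pn; exists x; rewrite in_rest xS.
apply: (structure_leq (card_ker_gt0 kerf) (leq_card_fksum st) _ cS0 _ cS').
- exact: (card_fksum_structure kerf s0S holes s0min P1 apS).
- by apply: leq_card_fsuml.
apply: IHn apS0; last by apply/fset0Pn; exists s0.
by apply: leq_trans Sn; rewrite cS0 -addn1 leq_add2l.
Qed.

(** * Hyper-atoms *)

Section Core.
Variables (G G' : zmodType) (f : {additive G -> G'}) (H : {fset G}).
Hypothesis kerf : forall x, (f x == 0) = (x \in H).
Variables (K : set G) (S : {fset G}) (s0 : G) (k : nat).
Hypotheses (gK : subgroup K) (S0 : 0 \in S) (SK : fincl S K) (HK : fincl H K).
Hypothesis Sgen :
  forall L : set G, subgroup L -> fincl S L -> forall x, K x -> L x.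
Hypothesis mHS : misses K (fsum H S).
Hypothesis Hmin : forall X, admissible_fset K S X ->
  (#|` fsum H S| + #|` X| <= #|` fsum X S| + #|` H|)%N.
Hypothesis Hmax : forall L : {fset G}, subgroup [set` L] ->
  admissible_fset K S L -> H `<=` L ->
  (#|` fsum L S| + #|` H| <= #|` fsum H S| + #|` L|)%N -> L = H.
Hypotheses (s0S : s0 \in S)
  (S0min : {in S, forall x, (#|` fcomp f S s0| <= #|` fcomp f S x|)%N}).
Hypothesis kS_aper : faperiodic (fksum k S).
Hypothesis kS_card : (#|` fksum k S| + k = k * #|` S| + 1)%N.

Let T := fimage f S.
Let fK : set G' := (f @` K)%classic.

Let T1 : (1 < #|` T|)%N := card_fimage_gt1 kerf gK S0 Sgen mHS.
Let iT : isoperimetric fK T := isoperimetric_image kerf gK HK Hmin.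
Let gfK : subgroup fK := subgroup_image f gK.
Let T0 : 0 \in T. Proof. by rewrite -(raddf0 f) mem_fimage. Qed.
Let TfK : fincl T fK := fincl_fimage SK.

(** Compare [H] with the one-point set {0}. *)
Lemma fragment_holes : ((#|` fsum H S|).+1 <= #|` H| + #|` S|)%N.
Proof.
have adm0 : admissible_fset K S [fset 0].
  split; first by apply/fset0Pn; exists 0; rewrite inE.
    by move=> x; rewrite inE => /eqP->; apply: (subgroup0 gK).
  by apply: missesS mHS; rewrite fsumS // fsub1set (ker0 kerf).
by have := Hmin adm0; rewrite fsum0s cardfs1 addn1 addnC.
Qed.

(** Equality passes from kT down to 2T and 3T. The first gives the doubling condition of
    [vosper_arith_prog], the second makes [fK] large enough for it. *)
Lemma arith_prog_image : (2 < k)%N -> steps k T ->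
  (#|` fksum k T| + k <= k * #|` T| + 1)%N -> arith_prog [set` T].
Proof.
move=> k3 st cT.
have c2 := card_fksum_eq st (ltnW k3) cT.
have c3 := card_fksum_eq st k3 cT.
apply: (vosper_arith_prog (K := fK)) => //.
- move=> L gL TL _ [x Kx <-].
  have gfL : subgroup [set y | L (f y)].
    split; first by rewrite /= raddf0; apply: (subgroup0 gL).
    by move=> y z /= Ly Lz; rewrite raddfB; apply: (subgroupB gL).
  by apply: (Sgen gfL _ Kx) => y yS; apply/TL/mem_fimage.
- exact: (no_subgroup_fragment_image kerf gK HK Hmax).
- by move: c2; rewrite fksumS fksum1; clear; lia.
apply: (size_ge_fincl (fincl_fksum (k := 3) gfK TfK)).
by move: c3; clear; lia.
Qed.

Lemma hyper_atom_structure : (2 < k)%N ->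
  [/\ fsum (S `\` fcomp f S s0) H = S `\` fcomp f S s0,
      (#|` fksum k (fcomp f S s0)| + k = k * #|` fcomp f S s0| + 1)%N &
      arith_prog [set` T]].
Proof.
move=> k3; have holes := fragment_holes.
(* For H = {0}, [f] preserves cardinalities and components are points. [fksum_unique] needs a
   nonzero element of [H], so here the increments come from kS missing a point of [K], by
   aperiodicity. *)
have [H1|H1] := leqP #|` H| 1.
  have H0 x : x \in H -> x = 0.
    move=> xH; apply/eqP; apply: contraLR H1 => x0; rewrite -ltnNge.
    exact: (card_fset_gt1 xH (ker0 kerf)).
  have HE : H = [fset 0].
    apply/fsetP=> x; rewrite inE; apply/idP/eqP => [/H0//|->]; exact: (ker0 kerf).
  have sumH A : fsum A H = A by rewrite HE fsumC fsum0s.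
  have cim A : #|` fimage f A| = #|` A|.
    by rewrite (card_fperiodic kerf (sumH A)) HE cardfs1 muln1.
  have S0E n : fksum n (fcomp f S s0) = [fset s0 *+ n].
    apply/fsetP=> x; rewrite inE; apply/idP/eqP => [/fimage_fksum_fcomp fx|->].
      apply/eqP; rewrite -subr_eq0; apply/eqP/H0.
      by rewrite -kerf raddfB raddfMn fx subrr.
    by apply: mulrn_fksum; rewrite in_fcomp s0S eqxx.
  split; first exact: sumH.
    by rewrite S0E -(fksum1 (fcomp f S s0)) S0E !cardfs1 muln1 addnC.
  apply: arith_prog_image => //; last by rewrite -fimage_fksum !cim kS_card.
  apply: (steps_of_misses gfK T0 TfK iT); rewrite -fimage_fksum.
  apply: (misses_image kerf); rewrite sumH; apply: misses_fksum => //.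
  by rewrite -cim.
have [j kE] : exists j, k = j.+2 by case: k k3 => [|[|j]] // _; exists j.
move: kS_aper kS_card; rewrite kE => apS cS.
have st : steps k T.
  rewrite kE; apply: (steps_of_unique gfK T0 TfK iT T1 (mem_fimage f s0S)).
  exact: (fksum_unique kerf s0S holes S0min H1 apS).
have apS0 := faperiodic_fksum_fcomp kerf s0S holes S0min apS.
have S0n0 : fcomp f S s0 != fset0.
  by apply/fset0Pn; exists s0; rewrite in_fcomp s0S eqxx.
have stj := leq_card_fksum st; rewrite kE in stj.
have Hn0 : H != fset0 by rewrite -cardfs_gt0 ltnW.
have [cS' cS0 cT] := structure_eq (ltn0Sn _) (card_ker_gt0 kerf) stj
  (card_fksum_structure kerf s0S holes S0min H1 apS) (card_rest f S s0)
  (leq_card_fsuml _ Hn0) (card_rest_ker kerf s0S) (kneser_fksum S0n0 apS0) cS.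
split=> //; last by apply: arith_prog_image => //; rewrite kE.
by apply/eqP; rewrite eq_sym eqEfcard fsum_subl ?(ker0 kerf).
Qed.

End Core.

(** * From finite sets to classical sets *)

Section Sets.
Variable G : zmodType.
Implicit Types A B : {fset G}.

Lemma card_set_fset A : card [set` A] = #|` A|.
Proof. by rewrite /card set_fsetK. Qed.

Lemma set_fset_inj A B : [set` A]%classic = [set` B]%classic -> A = B.
Proof. by move=> /(congr1 (@fset_set _)); rewrite !set_fsetK. Qed.

Lemma sumset_fset A B : sumset [set` A] [set` B] = [set` fsum A B]%classic.
Proof.
apply/seteqP; split=> z /=.
  by case=> x xA [y yB <-]; apply: mem_fsum.
by case/fsumP=> x [y [xA yB ->]]; exists x => //; exists y.
Qed.

Lemma translate_fset x A : translate x [set` A] = [set` fshift x A]%classic.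
Proof.
apply/seteqP; split=> z /=; first by case=> y yA <-; rewrite mem_fshift.
by rewrite in_fshift => zA; exists (z - x) => //; rewrite addrC subrK.
Qed.

Lemma ksum_fset k A : ksum k [set` A] = [set` fksum k A]%classic.
Proof.
elim: k => [|k IHk]; last by rewrite fksumS -sumset_fset -IHk.
by apply/seteqP; split=> z /=; rewrite inE => /eqP.
Qed.

Lemma aperiodic_fset A : aperiodic [set` A] -> faperiodic A.
Proof.
move=> apA x xA; have : [set y | translate y [set` A] = [set` A]]%classic x.
  by rewrite /= translate_fset xA.
by rewrite apA.
Qed.

(** A minimum exists among the admissible sets, so the [xget] in [kappa1] returns it and does not
    fall back on its default. *)
Lemma fragment_min (S : set G) a X Y : fragment S a X -> admissible S a Y ->
  (card (sumset X S) - card X <= card (sumset Y S) - card Y)%N.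
Proof.
move=> [admX ->] admY.
have [Z admZ Zmin] := @exists_minimal _
  (fun Z => (card (sumset Z S) - card Z)%N) _ (ex_intro _ X admX).
have [_] : [set n |
    (exists2 X, admissible S a X & n = (card (sumset X S) - card X)%N) /\
    (forall X, admissible S a X -> (n <= card (sumset X S) - card X)%N)]%classic
    (kappa1 S a).
  apply: xgetPex; exists (card (sumset Z S) - card Z)%N; split; last exact: Zmin.
  by exists Z.
exact.
Qed.

End Sets.

Local Open Scope classical_set_scope.

Lemma arith_prog_translate (G : zmodType) (A : set G) x :
  arith_prog A -> arith_prog (translate x A).
Proof.
move=> [a [d [m [m0 ->]]]]; exists (x + a), d, m; split=> //.
apply/seteqP; split=> z /=.
  by case=> _ [i im <-] <-; exists i => //; rewrite addrA.
by case=> i im <-; exists (a + d *+ i); rewrite ?addrA //; exists i.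
Qed.

Theorem corollary18 (G : zmodType) (k : nat) (S : set G) (a : G)
    (H : zmodClosed G) (S0 : set G)
    (k_ge3 : (3 <= k)%N)
    (finS : finite_set S) (S_neq0 : S !=set0)
    (S_not_ap : ~ arith_prog S)
    (kS_aper : aperiodic (ksum k S))
    (kS_card : card (ksum k S) = (k * card S - k + 1)%N)
    (aS : S a)
    (H_hyper : hyper_atom S a [set x | x \in H])
    (S0_min : smallest_component [set x | x \in H] S S0) :
  [/\ sumset (S `\` S0) [set x | x \in H] = S `\` S0,
      card (ksum k S0) = (k * card S0 - k + 1)%N &
      arith_prog (quot_map H @` S)].
Proof.
have [[gH [admH fragH] Hmax] [[S0n0 [x S0E]] S0min]] := (H_hyper, S0_min).
have [finH _ _ _] := admH.
set Hs := [set x | x \in H] in gH admH fragH Hmax finH S0E S0min *.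
have [Hf HE] : exists Hf : {fset G}, Hs = [set` Hf].
  by exists (fset_set Hs); rewrite fset_setK.
have HfP y : (y \in Hf) = (y \in H).
  apply/idP/idP => yH; first by have : Hs y by rewrite HE.
  by have : Hs y by []; rewrite HE.
have kerf y : (quot_map H y == 0) = (y \in Hf) by rewrite quot_map_eq0 HfP.
pose f : {additive G -> Quotient.quot H} := quot_map H.
have [Sf SE] : exists Sf : {fset G}, S = [set` Sf].
  by exists (fset_set S); rewrite fset_setK.
subst S; move: kS_card; rewrite ksum_fset !card_set_fset => kS_card.
rewrite ksum_fset in kS_aper; move/aperiodic_fset in kS_aper.
rewrite HE in gH admH fragH Hmax S0E S0min *.
(* [S1] contains [0] and generates [K], the subgroup generated by the differences of [S]. *)
pose K := diff_subgroup [set` Sf]; pose S1 := fshift (- a) Sf.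
have gK : subgroup K := subgroup_gen _.
have S1K : fincl S1 K.
  move=> y; rewrite in_fshift opprK => yS; apply: gen_subgroup_sub.
  by exists (y + a) => //; exists a; rewrite ?addrK.
have S1gen (L : set G) : subgroup L -> fincl S1 L -> forall y, K y -> L y.
  move=> gL S1L; apply: (gen_subgroup_min gL) => _ [u uS [v vS <-]].
  have -> : u - v = (- a + u) - (- a + v) by rewrite opprD addrACA subrr add0r.
  by apply: (subgroupB gL); apply: S1L; rewrite mem_fshift.
have S1_0 : 0 \in S1 by rewrite in_fshift opprK add0r.
have sumE (X : {fset G}) :
    sumset [set` X] (translate (- a) [set` Sf]) = [set` fsum X S1].
  by rewrite translate_fset sumset_fset.
have cardE (X : {fset G}) : card (sumset [set` X] [set` Sf]) = #|` fsum X S1|.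
  by rewrite sumset_fset card_set_fset fsumC -(card_fshift (- a)) -fsum_fshift fsumC.
have S1n0 : S1 != fset0 by apply/fset0Pn; exists 0.
have admE (X : {fset G}) :
    admissible_fset K S1 X -> admissible [set` Sf] a [set` X].
  move=> [/fset0Pn[y yX] XK [z Kz zX]]; split=> //; first by exists y.
  by rewrite sumE => e; case/negP: zX; have : [set` fsum X S1] z by rewrite e.
have [_ _ HK HSK] := admH.
have mHS : misses K (fsum Hf S1).
  apply: contrapT => /not_misses KHS; apply: HSK; rewrite sumE.
  apply/seteqP; split=> y /=; first exact: (fincl_fsum gK HK S1K).
  exact: KHS.
have Hmin X : admissible_fset K S1 X ->
    (#|` fsum Hf S1| + #|` X| <= #|` fsum X S1| + #|` Hf|)%N.
  move=> /admE/(fragment_min (conj admH fragH)); rewrite !cardE !card_set_fset.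
  (* These bounds make the truncated differences of cardinalities exact. *)
  have := leq_card_fsuml X S1n0; have := leq_card_fsuml Hf S1n0.
  by clear; lia.
have {}Hmax (L : {fset G}) : subgroup [set` L] ->
    admissible_fset K S1 L -> (Hf `<=` L)%fset ->
    (#|` fsum L S1| + #|` Hf| <= #|` fsum Hf S1| + #|` L|)%N -> L = Hf.
  move=> gL admL HL cL; apply: set_fset_inj; apply: Hmax => //; last exact/fsubsetP.
  split; first exact: admE.
  rewrite -fragH !cardE !card_set_fset.
  have := leq_card_fsuml L S1n0; have := leq_card_fsuml Hf S1n0.
  by have := Hmin _ admL; move: cL; clear; lia.
have [s0 S0s0] := S0n0.
have compE y : [set` Sf] `&` translate y [set` Hf] = [set` fcomp f Sf y].
  apply/seteqP; split=> z /=; rewrite translate_fset.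
    by move=> [zS /= zH]; rewrite in_fcomp zS (eq_fimage kerf) -in_fshift.
  by rewrite in_fcomp (eq_fimage kerf) -in_fshift => /andP[].
(* The base point [x] of the component is replaced by one of its own points. *)
have {S0E}S0E : S0 = [set` fcomp f Sf s0].
  move: S0s0; rewrite S0E compE /= in_fcomp => /andP[_ /eqP fs0].
  suff -> : fcomp f Sf x = fcomp f Sf s0 by [].
  by apply/fsetP=> z; rewrite !in_fcomp fs0.
have s0S : s0 \in Sf by move: S0s0; rewrite S0E /= in_fcomp => /andP[].
subst S0.
have compS1 y : fcomp f S1 (- a + y) = fshift (- a) (fcomp f Sf y).
  apply/fsetP=> z; rewrite in_fcomp !in_fshift in_fcomp; congr (_ && _).
  rewrite raddfB raddfD !raddfN opprK addrC -subr_eq0 opprD opprK addrA.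
  by rewrite -[RHS]subr_eq0 addrAC.
have S1min : {in S1, forall y,
    (#|` fcomp f S1 (- a + s0)| <= #|` fcomp f S1 y|)%N}.
  move=> y yS1; have -> : y = - a + (a + y) by rewrite addKr.
  rewrite !compS1 !card_fshift -!card_set_fset; apply: S0min; split; last first.
    by exists (a + y); rewrite compE.
  by exists (a + y); rewrite /= in_fcomp eqxx -(mem_fshift (- a)) addKr yS1.
have Sf1 : (0 < #|` Sf|)%N by rewrite cardfs_gt0; apply/fset0Pn; exists a.
have [|||A1 A2 A3] := hyper_atom_structure kerf gK S1_0 S1K HK S1gen mHS Hmin Hmax
  (s0 := - a + s0) _ S1min (k := k) _ _ k_ge3.
- by rewrite mem_fshift.
- by rewrite fksum_fshift; apply: faperiodic_fshift.
(* [S] is non-empty, so the truncated subtraction of [k] in [kS_card] is exact. *)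
- rewrite fksum_fshift !card_fshift kS_card; move: Sf1 k_ge3; clear.
  by nia.
rewrite compS1 in A1 A2.
split.
- have -> : [set` Sf] `\` [set` fcomp f Sf s0] = [set` (Sf `\` fcomp f Sf s0)%fset].
    apply/seteqP; split=> z /=; rewrite in_fsetD.
      by case=> zS /negP zS0; rewrite zS zS0.
    by case/andP=> /negP.
  rewrite sumset_fset.
  suff -> : fsum (Sf `\` fcomp f Sf s0)%fset Hf = (Sf `\` fcomp f Sf s0)%fset by [].
  have := congr1 (fshift a) A1.
  have -> : (S1 `\` fshift (- a) (fcomp f Sf s0))%fset =
      fshift (- a) (Sf `\` fcomp f Sf s0)%fset.
    by apply/fsetP=> z; rewrite !(in_fsetD, in_fshift).
  by rewrite fsum_fshift !fshiftD subrr !fshift0.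
- rewrite ksum_fset !card_set_fset; move: A2; rewrite fksum_fshift !card_fshift.
  have : (0 < #|` fcomp f Sf s0|)%N.
    by rewrite cardfs_gt0; apply/fset0Pn; exists s0; rewrite in_fcomp s0S eqxx.
  by clear; nia.
(* The initial translation by [-a] is undone in the quotient. *)
have -> : quot_map H @` [set` Sf] = translate (f a) [set` fimage f S1].
  rewrite translate_fset; apply/seteqP; split=> z /=.
    move=> [y yS <-]; rewrite in_fshift; apply/fimageP.
    by exists (- a + y); rewrite ?mem_fshift // raddfD raddfN addrC.
  rewrite in_fshift => /fimageP[y]; rewrite in_fshift opprK => yS fz.
  by exists (y + a) => //; rewrite raddfD -fz subrK.
exact: arith_prog_translate.
Qed.
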